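(* For every positive integer $n$, the 2-page crossing number of the complete graph satisfies \[ \nu_2(K_n)=Z(n):=\frac14\left\lfloor\frac n2\right\rfloor\left\lfloor\frac{n-1}2\right\rfloor\left\lfloor\frac{n-2}2\right\rfloor\left\lfloor\frac{n-3}2\right\rfloor . \]
   Context: A 2-page book drawing of a graph is a drawing in the plane in which all vertices lie on a line (the spine) and each edge is a simple arc contained entirely in one of the two closed half-planes (pages) determined by the spine. The 2-page crossing number $\nu_2(G)$ is the minimum number of crossings over all 2-page book drawings of $G$ (a crossing being a pair consisting of a point and two distinct edges whose arcs both pass through that point). *)

(* Defs.v *)
From Stdlib Require Import Reals List.
Open Scope R_scope.

(* Points of the plane; the spine is the x-axis { (x,0) }. *)
Definition point := (R * R)%type.

Definition in01 (t : R) : Prop := 0 <= t <= 1.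
Definition in01_open (t : R) : Prop := 0 < t < 1.

Definition cont_on01 (g : R -> point) : Prop :=
  forall t, in01 t -> forall eps, 0 < eps ->
    exists delta, 0 < delta /\
      forall s, in01 s -> Rabs (s - t) < delta ->
        Rabs (fst (g s) - fst (g t)) < eps /\ Rabs (snd (g s) - snd (g t)) < eps.

Definition simple_arc (g : R -> point) : Prop :=
  cont_on01 g /\ (forall s t, in01 s -> in01 t -> g s = g t -> s = t).

Definition is_edge (n : nat) (e : nat * nat) : Prop :=
  (fst e < snd e)%nat /\ (snd e < n)%nat.

(* A 2-page book drawing of K_n:
   - pos k : position on the spine of vertex k (distinct for distinct vertices),
   - page e : the page (true = upper closed half-plane y >= 0,
              false = lower closed half-plane y <= 0) of edge e,
   - arc e : parametrization on [0,1] of the arc of edge e. *)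
Record drawing2 (n : nat) := Drawing2 {
  pos : nat -> R;
  page : nat * nat -> bool;
  arc : nat * nat -> R -> point
}.
Arguments pos {n}. Arguments page {n}. Arguments arc {n}.

Definition vertex_pt {n} (D : drawing2 n) (k : nat) : point := (pos D k, 0).

Definition valid_drawing2 (n : nat) (D : drawing2 n) : Prop :=
  (forall i j, (i < n)%nat -> (j < n)%nat -> pos D i = pos D j -> i = j) /\
  forall e, is_edge n e ->
    simple_arc (arc D e) /\
    arc D e 0 = vertex_pt D (fst e) /\
    arc D e 1 = vertex_pt D (snd e) /\
    (forall t, in01 t ->
       if page D e then 0 <= snd (arc D e t) else snd (arc D e t) <= 0) /\
    (forall t k, in01 t -> (k < n)%nat -> arc D e t = vertex_pt D k ->
       k = fst e \/ k = snd e).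

(* Strict lexicographic order, used to count each unordered pair of
   distinct edges once. *)
Definition edge_lt (e f : nat * nat) : Prop :=
  (fst e < fst f)%nat \/ (fst e = fst f /\ (snd e < snd f)%nat).

(* A crossing: a point together with two distinct edges whose arcs both pass
   through that point (at interior points of the arcs, i.e. not a shared
   endpoint). *)
Definition crossing (n : nat) (D : drawing2 n) (c : point * (nat * nat) * (nat * nat)) : Prop :=
  let '(p, e, f) := c in
  is_edge n e /\ is_edge n f /\ edge_lt e f /\
  (exists s t, in01_open s /\ in01_open t /\ arc D e s = p /\ arc D f t = p).

Definition cr_le (n : nat) (D : drawing2 n) (k : nat) : Prop :=
  exists L : list (point * (nat * nat) * (nat * nat)),
    (length L <= k)%nat /\ forall c, crossing n D c -> In c L.

Definition Zfloor (n : nat) (a : Z) : R :=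
  IZR (Z.div (Z.of_nat n - a) 2).

Definition Zn (n : nat) : R :=
  / 4 * (Zfloor n 0 * Zfloor n 1 * Zfloor n 2 * Zfloor n 3).

(* Main.v *)
From Stdlib Require Import Reals List ZArith Arith Bool Lia Lra ZifyBool.
From Stdlib Require Import ClassicalEpsilon.
From Coquelicot Require Import Compactness.
Require Import Defs.

(** Number the vertices along the spine and colour each edge by its page.  Two
    edges [a c] and [b d] with [a < b < c < d] on one page must cross, so the
    lower bound concerns the number [X] of monochromatic interleaved pairs in a
    2-coloured complete graph.  Orienting triangles as in the drawing, let [L]
    and [R] count the vertices on the two sides of an edge.  Inspecting
    quadruples gives [X = 3 C(n,4) - sum L R], and [L R] is an affine
    combination of the truncations [max 0 (k - L) + max 0 (k - R)].  Their sums
    over all edges are at least [3 C(k+2,3)]: delete the last vertex, whose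
    edges have side counts [0, ..., n-2], each twice, and note that for [i < k]
    the [i]-th vertex is the left end of at least [k - i] edges having fewer
    than [k] vertices on the side that does not lose the deleted vertex.

    That two interleaved paths in a half-plane meet is a degree argument: on a
    fine grid of parameters, the difference of the paths crosses the positive
    [x]-axis an odd number of times along one vertical side of the square, an
    even number of times along the other, and never along the horizontal sides.

    For the upper bound, the edges are drawn as parabolas with the same
    curvature, and the pages are those of half of the consecutive classes of
    parallel chords of a regular polygon. *)

Open Scope Z_scope.

(** * Finite sums over increasing tuples *)

Fixpoint zsum (n : nat) (f : nat -> Z) : Z :=
  match n with O => 0 | S m => zsum m f + f m end.

Definition zsum2 (n : nat) (f : nat -> nat -> Z) : Z :=
  zsum n (fun j => zsum j (fun i => f i j)).

Definition zsum3 (n : nat) (f : nat -> nat -> nat -> Z) : Z :=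
  zsum n (fun k => zsum2 k (fun i j => f i j k)).

Definition zsum4 (n : nat) (f : nat -> nat -> nat -> nat -> Z) : Z :=
  zsum n (fun l => zsum3 l (fun i j k => f i j k l)).

Lemma zsum2_S (n : nat) (f : nat -> nat -> Z) :
  zsum2 (S n) f = zsum2 n f + zsum n (fun i => f i n).
Proof. reflexivity. Qed.

Lemma zsum3_S (n : nat) (f : nat -> nat -> nat -> Z) :
  zsum3 (S n) f = zsum3 n f + zsum2 n (fun i j => f i j n).
Proof. reflexivity. Qed.

Lemma zsum4_S (n : nat) (f : nat -> nat -> nat -> nat -> Z) :
  zsum4 (S n) f = zsum4 n f + zsum3 n (fun i j k => f i j k n).
Proof. reflexivity. Qed.

Lemma zsum_ext (n : nat) (f g : nat -> Z) :
  (forall i, (i < n)%nat -> f i = g i) -> zsum n f = zsum n g.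
Proof.
  induction n as [|n IH]; intros H; [reflexivity|].
  simpl; rewrite IH, H by (intros; try apply H; lia); reflexivity.
Qed.

Lemma zsum2_ext (n : nat) (f g : nat -> nat -> Z) :
  (forall i j, (i < j)%nat -> (j < n)%nat -> f i j = g i j) ->
  zsum2 n f = zsum2 n g.
Proof.
  intros H; apply zsum_ext; intros j Hj; apply zsum_ext; intros i Hi.
  apply H; lia.
Qed.

Lemma zsum3_ext (n : nat) (f g : nat -> nat -> nat -> Z) :
  (forall i j k, (i < j)%nat -> (j < k)%nat -> (k < n)%nat ->
     f i j k = g i j k) ->
  zsum3 n f = zsum3 n g.
Proof.
  intros H; apply zsum_ext; intros k Hk; apply zsum2_ext; intros i j Hi Hj.
  apply H; lia.
Qed.

Lemma zsum4_ext (n : nat) (f g : nat -> nat -> nat -> nat -> Z) :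
  (forall i j k l, (i < j)%nat -> (j < k)%nat -> (k < l)%nat -> (l < n)%nat ->
     f i j k l = g i j k l) ->
  zsum4 n f = zsum4 n g.
Proof.
  intros H; apply zsum_ext; intros l Hl; apply zsum3_ext; intros i j k Hi Hj Hk.
  apply H; lia.
Qed.

Lemma zsum_le (n : nat) (f g : nat -> Z) :
  (forall i, (i < n)%nat -> f i <= g i) -> zsum n f <= zsum n g.
Proof.
  induction n as [|n IH]; intros H; simpl; [lia|].
  specialize (IH (fun i Hi => H i ltac:(lia))).
  specialize (H n ltac:(lia)); lia.
Qed.

Lemma zsum_add (n : nat) (f g : nat -> Z) :
  zsum n (fun i => f i + g i) = zsum n f + zsum n g.
Proof. induction n as [|n IH]; simpl; lia. Qed.

Lemma zsum_mul (n : nat) (c : Z) (f : nat -> Z) :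
  zsum n (fun i => c * f i) = c * zsum n f.
Proof. induction n as [|n IH]; simpl; lia. Qed.

Lemma zsum_mul_r (n : nat) (c : Z) (f : nat -> Z) :
  zsum n (fun i => f i * c) = zsum n f * c.
Proof. induction n as [|n IH]; simpl; lia. Qed.

Lemma zsum_const (n : nat) (c : Z) : zsum n (fun _ => c) = Z.of_nat n * c.
Proof. induction n as [|n IH]; cbn [zsum]; lia. Qed.

Lemma zsum_zero (n : nat) (f : nat -> Z) :
  (forall i, (i < n)%nat -> f i = 0) -> zsum n f = 0.
Proof.
  intros H; rewrite (zsum_ext n f (fun _ => 0) H), zsum_const; lia.
Qed.

Lemma zsum2_add (n : nat) (f g : nat -> nat -> Z) :
  zsum2 n (fun i j => f i j + g i j) = zsum2 n f + zsum2 n g.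
Proof.
  unfold zsum2; rewrite <- zsum_add; apply zsum_ext; intros; apply zsum_add.
Qed.

Lemma zsum2_mul (n : nat) (c : Z) (f : nat -> nat -> Z) :
  zsum2 n (fun i j => c * f i j) = c * zsum2 n f.
Proof.
  unfold zsum2; rewrite <- zsum_mul; apply zsum_ext; intros; apply zsum_mul.
Qed.

Lemma zsum3_add (n : nat) (f g : nat -> nat -> nat -> Z) :
  zsum3 n (fun i j k => f i j k + g i j k) = zsum3 n f + zsum3 n g.
Proof.
  unfold zsum3; rewrite <- zsum_add; apply zsum_ext; intros; apply zsum2_add.
Qed.

Lemma zsum4_add (n : nat) (f g : nat -> nat -> nat -> nat -> Z) :
  zsum4 n (fun i j k l => f i j k l + g i j k l) = zsum4 n f + zsum4 n g.
Proof.
  unfold zsum4; rewrite <- zsum_add; apply zsum_ext; intros; apply zsum3_add.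
Qed.

Lemma zsum_exchange (m n : nat) (f : nat -> nat -> Z) :
  zsum m (fun i => zsum n (fun j => f i j)) =
  zsum n (fun j => zsum m (fun i => f i j)).
Proof.
  induction m as [|m IH]; simpl.
  - symmetry; apply zsum_zero; reflexivity.
  - rewrite IH, <- zsum_add; reflexivity.
Qed.

Lemma zsum_zsum2_exchange (m n : nat) (f : nat -> nat -> nat -> Z) :
  zsum m (fun i => zsum2 n (fun r s => f i r s)) =
  zsum2 n (fun r s => zsum m (fun i => f i r s)).
Proof.
  unfold zsum2; rewrite zsum_exchange; apply zsum_ext; intros.
  apply zsum_exchange.
Qed.

Lemma zsum_S_l (n : nat) (f : nat -> Z) :
  zsum (S n) f = f O + zsum n (fun i => f (S i)).
Proof.
  induction n as [|n IH]; [simpl; lia|].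
  change (zsum (S (S n)) f) with (zsum (S n) f + f (S n)).
  rewrite IH; cbn [zsum]; lia.
Qed.

Lemma zsum_reverse (n : nat) (f : nat -> Z) :
  zsum n (fun i => f (n - 1 - i)%nat) = zsum n f.
Proof.
  induction n as [|n IH]; [reflexivity|].
  rewrite zsum_S_l.
  rewrite (zsum_ext n _ (fun i => f (n - 1 - i)%nat))
    by (intros; f_equal; lia).
  rewrite IH; cbn [zsum]; replace (S n - 1 - 0)%nat with n by lia; lia.
Qed.

Lemma zsum_restrict (n m : nat) (f : nat -> Z) :
  (m <= n)%nat -> zsum n (fun i => Z.b2z (i <? m)%nat * f i) = zsum m f.
Proof.
  induction n as [|n IH]; intros H.
  - replace m with O by lia; reflexivity.
  - destruct (Nat.eq_dec m (S n)) as [->|Hne].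
    + apply zsum_ext; intros i Hi.
      replace (i <? S n)%nat with true by lia; simpl Z.b2z; lia.
    + simpl; rewrite IH by lia.
      replace (n <? m)%nat with false by lia; simpl Z.b2z; lia.
Qed.

Lemma zsum_interval (n lo hi : nat) :
  (lo <= hi)%nat -> (hi <= n)%nat ->
  zsum n (fun i => Z.b2z ((lo <=? i) && (i <? hi))%nat) =
  Z.of_nat hi - Z.of_nat lo.
Proof.
  intros H1 H2.
  assert (H : zsum n (fun i => Z.b2z ((lo <=? i) && (i <? hi))%nat) +
              zsum n (fun i => Z.b2z (i <? lo)%nat * 1) =
              zsum n (fun i => Z.b2z (i <? hi)%nat * 1)).
  { rewrite <- zsum_add; apply zsum_ext; intros i Hi; lia. }
  rewrite !zsum_restrict, !zsum_const in H by lia; lia.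
Qed.

Lemma zsum2_rectangle (n : nat) (f : nat -> nat -> Z) :
  zsum2 n f =
  zsum n (fun i => zsum n (fun j => Z.b2z (i <? j)%nat * f i j)).
Proof.
  rewrite zsum_exchange; apply zsum_ext; intros j Hj.
  rewrite zsum_restrict by lia; reflexivity.
Qed.

Lemma zsum_square_pairs (n : nat) (f : nat -> nat -> Z) :
  (forall i, f i i = 0) ->
  zsum n (fun i => zsum n (fun j => f i j)) =
  zsum2 n (fun i j => f i j + f j i).
Proof.
  intros H0; induction n as [|n IH]; [reflexivity|].
  rewrite zsum2_S, <- IH; cbn [zsum].
  rewrite H0, zsum_add, (zsum_add n (fun i => f i n) (fun i => f n i)); lia.
Qed.

(** The index [i] is the smallest, the middle or the largest of the three; the hypotheses remove the
    coincidences [i = r] and [i = s]. *)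
Lemma zsum_zsum2_triples (n : nat) (h : nat -> nat -> nat -> Z) :
  (forall r s, h r r s = 0) -> (forall r s, h s r s = 0) ->
  zsum n (fun i => zsum2 n (fun r s => h i r s)) =
  zsum3 n (fun a b c => h a b c + h b a c + h c a b).
Proof.
  intros H1 H2; induction n as [|n IH]; [reflexivity|].
  rewrite zsum3_S, <- IH; cbn [zsum].
  rewrite (zsum_ext n _ (fun i => zsum2 n (fun r s => h i r s)
                                  + zsum n (fun r => h i r n)))
    by (intros; apply zsum2_S).
  rewrite zsum2_S, zsum_add.
  rewrite (zsum_zero n (fun i => h n i n)) by auto.
  rewrite (zsum_square_pairs n (fun i r => h i r n)) by auto.
  rewrite (zsum2_add n (fun a b => h a b n + h b a n) (fun a b => h n a b)).
  lia.
Qed.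

(** Pairs sharing an index contribute nothing, and a quadruple splits into two ordered disjoint
    pairs in six ways. *)
Lemma zsum2_zsum2_quadruples (n : nat) (g : nat -> nat -> nat -> nat -> Z) :
  (forall i j s, g i j i s = 0) -> (forall i j r, g i j r i = 0) ->
  (forall i j s, g i j j s = 0) -> (forall i j r, g i j r j = 0) ->
  zsum2 n (fun i j => zsum2 n (fun r s => g i j r s)) =
  zsum4 n (fun a b c d =>
    g a b c d + g a c b d + g b c a d + (g a d b c + g b d a c + g c d a b)).
Proof.
  intros H1 H2 H3 H4; induction n as [|n IH]; [reflexivity|].
  rewrite zsum4_S, <- IH, zsum2_S.
  rewrite (zsum2_ext n _ (fun i j => zsum2 n (fun r s => g i j r s)
                                     + zsum n (fun r => g i j r n)))
    by (intros; apply zsum2_S).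
  rewrite (zsum_ext n (fun i => zsum2 (S n) _)
             (fun i => zsum2 n (fun r s => g i n r s)
                       + zsum n (fun r => g i n r n)))
    by (intros; apply zsum2_S).
  rewrite zsum2_add, zsum_add.
  rewrite (zsum_zero n (fun i => zsum n (fun r => g i n r n)))
    by (intros; apply zsum_zero; auto).
  rewrite <- (zsum_zsum2_exchange n n (fun r i j => g i j r n)).
  rewrite (zsum_zsum2_triples n (fun r i j => g i j r n)) by auto.
  rewrite (zsum_zsum2_triples n (fun i r s => g i n r s)) by auto.
  rewrite (zsum3_add n (fun a b c => g a b c n + g a c b n + g b c a n)).
  rewrite (zsum3_ext n (fun a b c => g b c a n + g a c b n + g a b c n)
    (fun a b c => g a b c n + g a c b n + g b c a n)) by (intros; lia).
  lia.
Qed.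

Lemma zsum2_one (n : nat) :
  2 * zsum2 n (fun _ _ => 1) = Z.of_nat n * (Z.of_nat n - 1).
Proof.
  induction n as [|n IH]; [reflexivity|].
  rewrite zsum2_S, zsum_const, Nat2Z.inj_succ; nia.
Qed.

Lemma zsum3_one (n : nat) :
  6 * zsum3 n (fun _ _ _ => 1) =
  Z.of_nat n * (Z.of_nat n - 1) * (Z.of_nat n - 2).
Proof.
  induction n as [|n IH]; [reflexivity|].
  rewrite zsum3_S, Nat2Z.inj_succ; pose proof (zsum2_one n); nia.
Qed.

Lemma zsum4_one (n : nat) :
  24 * zsum4 n (fun _ _ _ _ => 1) =
  Z.of_nat n * (Z.of_nat n - 1) * (Z.of_nat n - 2) * (Z.of_nat n - 3).
Proof.
  induction n as [|n IH]; [reflexivity|].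
  rewrite zsum4_S, Nat2Z.inj_succ; pose proof (zsum3_one n); nia.
Qed.


(** * Sides of an edge in a two-coloured complete graph *)

(* In a 2-page drawing with the vertices numbered along the spine, the
   orientation of the triangle on [a < b < c] depends only on the page
   [col a c] of its longest edge.  [outer col i j r] says that [r] lies on the
   side of the edge [i j] that does not contain the vertices between [i] and
   [j]. *)
Definition outer (col : nat -> nat -> bool) (i j r : nat) : bool :=
  if (r <? i)%nat then eqb (col r j) (col i j)
  else if (r <=? j)%nat then false
  else eqb (col i r) (col i j).

Definition outer_ind (col : nat -> nat -> bool) (i j r : nat) : Z :=
  Z.b2z (negb (r =? i)%nat && negb (r =? j)%nat && outer col i j r).

(** Since [outer] is [false] at [i] and at [j], its negation alone would count both ends of the
    edge. *)
Definition inner_ind (col : nat -> nat -> bool) (i j r : nat) : Z :=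
  Z.b2z (negb (r =? i)%nat && negb (r =? j)%nat && negb (outer col i j r)).

Definition outer_count (col : nat -> nat -> bool) (n i j : nat) : Z :=
  zsum n (outer_ind col i j).

Definition inner_count (col : nat -> nat -> bool) (n i j : nat) : Z :=
  zsum n (inner_ind col i j).

Definition mono_crossings (col : nat -> nat -> bool) (n : nat) : Z :=
  zsum4 n (fun a b c d => Z.b2z (eqb (col a c) (col b d))).

Lemma outer_ind_ge0 col i j r : 0 <= outer_ind col i j r.
Proof. unfold outer_ind; lia. Qed.

Lemma inner_ind_ge0 col i j r : 0 <= inner_ind col i j r.
Proof. unfold inner_ind; lia. Qed.

Lemma outer_count_ge0 col n i j : 0 <= outer_count col n i j.
Proof.
  rewrite <- (zsum_zero n (fun _ => 0)) by auto.
  apply zsum_le; intros; apply outer_ind_ge0.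
Qed.

Lemma inner_count_ge0 col n i j : 0 <= inner_count col n i j.
Proof.
  rewrite <- (zsum_zero n (fun _ => 0)) by auto.
  apply zsum_le; intros; apply inner_ind_ge0.
Qed.

Lemma outer_inner_count col n i j :
  (i < j)%nat -> (j < n)%nat ->
  outer_count col n i j + inner_count col n i j = Z.of_nat n - 2.
Proof.
  intros Hij Hj; unfold outer_count, inner_count; rewrite <- zsum_add.
  assert (H : zsum n (fun r => outer_ind col i j r + inner_ind col i j r) +
     (zsum n (fun r => Z.b2z ((i <=? r) && (r <? S i))%nat) +
      zsum n (fun r => Z.b2z ((j <=? r) && (r <? S j))%nat)) =
     zsum n (fun _ => 1)).
  { rewrite <- !zsum_add; apply zsum_ext; intros r Hr.
    unfold outer_ind, inner_ind; destruct (outer col i j r); lia. }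
  rewrite !zsum_interval, zsum_const in H by lia; lia.
Qed.

(** No vertex lies on both sides, so the diagonal of the product vanishes; what remains counts the
    pairs of vertices separated by the edge. *)
Lemma outer_count_mul_inner_count col n i j :
  outer_count col n i j * inner_count col n i j =
  zsum2 n (fun r s => outer_ind col i j r * inner_ind col i j s +
                      outer_ind col i j s * inner_ind col i j r).
Proof.
  rewrite <- (zsum_square_pairs n
    (fun r s => outer_ind col i j r * inner_ind col i j s)).
  - unfold outer_count, inner_count; rewrite <- zsum_mul_r.
    apply zsum_ext; intros; symmetry; apply zsum_mul.
  - intros r; unfold outer_ind, inner_ind; destruct (outer col i j r); lia.
Qed.

Ltac decide_comparisons :=
  repeat match goal with
  | |- context [Nat.eqb ?a ?b] =>
      first [replace (Nat.eqb a b) with true by lia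
            |replace (Nat.eqb a b) with false by lia]
  | |- context [Nat.ltb ?a ?b] =>
      first [replace (Nat.ltb a b) with true by lia
            |replace (Nat.ltb a b) with false by lia]
  | |- context [Nat.leb ?a ?b] =>
      first [replace (Nat.leb a b) with true by lia
            |replace (Nat.leb a b) with false by lia]
  end.

(* In every quadruple [a < b < c < d] the number of edges separating the two
   other vertices is [3], or [2] if [a c] and [b d] have the same colour. *)
Lemma mono_crossings_identity col n :
  zsum2 n (fun i j => outer_count col n i j * inner_count col n i j) +
  mono_crossings col n = 3 * zsum4 n (fun _ _ _ _ => 1).
Proof.
  set (g := fun i j r s => outer_ind col i j r * inner_ind col i j s +
                           outer_ind col i j s * inner_ind col i j r).
  rewrite (zsum2_ext n _ (fun i j => zsum2 n (g i j)))
    by (intros; apply outer_count_mul_inner_count).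
  rewrite zsum2_zsum2_quadruples.
  2-5: intros; unfold g, outer_ind, inner_ind; rewrite !Nat.eqb_refl;
       cbn [negb andb Z.b2z]; rewrite ?andb_false_r; cbn [andb Z.b2z]; lia.
  unfold mono_crossings; rewrite <- zsum4_add.
  rewrite (zsum4_ext n _ (fun _ _ _ _ => 1 + (1 + 1))); [rewrite !zsum4_add; lia|].
  intros a b c d Hab Hbc Hcd Hd.
  unfold g, outer_ind, inner_ind, outer.
  decide_comparisons; cbn [negb andb].
  (* All 64 colourings of the six edges are checked by computation. *)
  destruct (col a b), (col a c), (col a d), (col b c), (col b d), (col c d);
    reflexivity.
Qed.


(** * The lower bound for the number of monochromatic crossings *)

Fixpoint count (n : nat) (c : nat -> bool) : nat :=
  match n with O => O | S m => (count m c + Nat.b2n (c m))%nat end.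

Lemma count_zsum n c : Z.of_nat (count n c) = zsum n (fun i => Z.b2z (c i)).
Proof. induction n as [|n IH]; cbn [count zsum]; [|destruct (c n)]; cbn [Nat.b2n Z.b2z]; lia. Qed.

Lemma zsum_app (p q : nat) (f : nat -> Z) :
  zsum (p + q) f = zsum p f + zsum q (fun t => f (p + t)%nat).
Proof.
  induction q as [|q IH]; [rewrite Nat.add_0_r; cbn [zsum]; lia|].
  rewrite Nat.add_succ_r; cbn [zsum]; lia.
Qed.

(** For [i] satisfying [c], [count i c] is its rank among such indices, and these ranks run once
    through [0, ..., count n c - 1]. *)
Lemma zsum_rank (n : nat) (c : nat -> bool) (f : nat -> Z) :
  zsum n (fun i => Z.b2z (c i) * f (count i c)) = zsum (count n c) f.
Proof.
  induction n as [|n IH]; [reflexivity|].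
  cbn [zsum count]; rewrite IH, zsum_app.
  destruct (c n); cbn [Z.b2z Nat.b2n zsum]; rewrite ?Nat.add_0_r; lia.
Qed.

(** For [x >= 0] this is the number of integers [t] with [x <= t < k]. *)
Definition weight (k : nat) (x : Z) : Z := Z.max 0 (Z.of_nat k - x).

(* In terms of the [<=j]-edges of the literature, for [2 k <= n - 1] this is
   [E_{<=0} + ... + E_{<=k-1}]. *)
Definition total_weight (col : nat -> nat -> bool) (k n : nat) : Z :=
  zsum2 n (fun i j => weight k (outer_count col n i j) +
                      weight k (inner_count col n i j)).

Lemma zsum_descending (m : nat) (a : Z) :
  2 * zsum m (fun t => a - Z.of_nat t) = Z.of_nat m * (2 * a - Z.of_nat m + 1).
Proof. induction m as [|m IH]; cbn [zsum]; nia. Qed.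

Lemma zsum_weight (k n : nat) :
  (k <= n)%nat ->
  2 * zsum n (fun t => weight k (Z.of_nat t)) = Z.of_nat k * (Z.of_nat k + 1).
Proof.
  intros H.
  rewrite (zsum_ext n _ (fun t => Z.b2z (t <? k)%nat * (Z.of_nat k - Z.of_nat t)))
    by (intros t _; unfold weight; destruct (Nat.ltb_spec t k); cbn [Z.b2z]; lia).
  rewrite zsum_restrict, zsum_descending by lia; lia.
Qed.

(** Vertices after [i] lie between [i] and [n], hence on the inner side; only earlier ones can be
    outer. *)
Lemma outer_count_last col n i :
  (i < n)%nat ->
  outer_count col (S n) i n =
  Z.of_nat (count i (fun r => eqb (col r n) (col i n))).
Proof.
  intros Hi; rewrite count_zsum; unfold outer_count.
  rewrite <- (zsum_restrict (S n) i) by lia.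
  apply zsum_ext; intros r Hr; unfold outer_ind, outer.
  destruct (Nat.ltb_spec r i), (Nat.leb_spec r n); try lia;
    decide_comparisons; cbn [andb negb Z.b2z]; lia.
Qed.

(** Within each colour class of edges at [n], the outer count is the rank of the edge. The two sides
    add up to [n - 1], so reversing the ranks of one class makes the two classes together fill
    [0, ..., n - 1], whatever their sizes. *)
Lemma last_column_weight col k n :
  (k <= n)%nat ->
  zsum n (fun i => weight k (outer_count col (S n) i n) +
                   weight k (inner_count col (S n) i n)) =
  Z.of_nat k * (Z.of_nat k + 1).
Proof.
  intros Hk.
  set (c := fun r => col r n); set (c' := fun r => negb (c r)).
  set (F := fun t => weight k (Z.of_nat t) + weight k (Z.of_nat n - 1 - Z.of_nat t)).
  assert (Hpq : (count n c + count n c')%nat = n).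
  { clearbody c; clear; subst c'; induction n as [|n IH]; [reflexivity|].
    cbn [count]; destruct (c n); cbn [Nat.b2n negb]; lia. }
  rewrite (zsum_ext n _ (fun i => Z.b2z (c i) * F (count i c) +
                                  Z.b2z (c' i) * F (count i c'))).
  2: { intros i Hi.
       pose proof (outer_inner_count col (S n) i n Hi ltac:(lia)) as HLR.
       pose proof (outer_count_last col n i Hi) as HL.
       replace (inner_count col (S n) i n)
         with (Z.of_nat n - 1 - outer_count col (S n) i n) by lia.
       assert (Hext : forall f g, (forall r, f r = g r) -> count i f = count i g).
       { intros f g Hfg; generalize i; intros m; induction m as [|m IH];
           cbn [count]; congruence. }
       rewrite HL; unfold c', c; destruct (col i n); cbn [negb Z.b2z]; unfold F.
       - rewrite (Hext _ (fun r => col r n)) by (intros r; destruct (col r n); reflexivity).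
         lia.
       - rewrite (Hext _ (fun r => negb (col r n))) by (intros r; destruct (col r n); reflexivity).
         lia. }
  rewrite zsum_add, !zsum_rank.
  set (p := count n c) in *; set (q := count n c') in *.
  (* [F] is invariant under [t -> n - 1 - t], which carries the ranks below [q] to
     [p, ..., n - 1]. *)
  assert (Hsum : zsum p F + zsum q F = zsum n F).
  { rewrite <- Hpq at 1; rewrite zsum_app; f_equal.
    rewrite <- (zsum_reverse q F); apply zsum_ext; intros t Ht; unfold F.
    rewrite Z.add_comm; f_equal; f_equal; lia. }
  rewrite Hsum; unfold F; rewrite zsum_add.
  rewrite <- (zsum_reverse n (fun t => weight k (Z.of_nat n - 1 - Z.of_nat t))).
  rewrite (zsum_ext n (fun i => weight k (Z.of_nat n - 1 - Z.of_nat (n - 1 - i)))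
    (fun t => weight k (Z.of_nat t))) by (intros; f_equal; lia).
  pose proof (zsum_weight k n Hk); lia.
Qed.

(* Counts the side of [i j] avoiding the vertex [n] when it has fewer than [k]
   vertices: deleting [n] does not shrink that side. *)
Definition invariant_ind (col : nat -> nat -> bool) (k n i j : nat) : Z :=
  Z.b2z (negb (outer col i j n) && (outer_count col (S n) i j <? Z.of_nat k)) +
  Z.b2z (outer col i j n && (inner_count col (S n) i j <? Z.of_nat k)).

(** For each [j > i], the side of [i j] without [n] has a size bounded by one of [i, ..., n - 2],
    each of these bounds serving exactly one [j]. At least [k - i] of the edges therefore have fewer
    than [k] vertices there. *)
Lemma row_invariants col k n i :
  (i < k)%nat -> (k < n)%nat ->
  Z.of_nat k - Z.of_nat i <=
  zsum n (fun j => Z.b2z (i <? j)%nat * invariant_ind col k n i j).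
Proof.
  intros Hi Hk.
  set (c := fun j => (i <? j)%nat && negb (eqb (col i n) (col i j))).
  set (c' := fun j => (i <? j)%nat && eqb (col i n) (col i j)).
  set (p := count n c); set (q := count n c').
  assert (Hcc : forall j, (i < j)%nat ->
    Z.of_nat (count j c) + Z.of_nat (count j c') = Z.of_nat j - Z.of_nat i - 1).
  { intros j Hj; rewrite !count_zsum, <- zsum_add.
    rewrite (zsum_ext j _ (fun r => Z.b2z ((S i <=? r) && (r <? j))%nat)).
    - rewrite zsum_interval; lia.
    - intros r Hr; unfold c, c'; destruct (eqb (col i n) (col i r)); lia. }
  assert (Hpq : Z.of_nat (p + q) = Z.of_nat n - Z.of_nat i - 1)
    by (rewrite Nat2Z.inj_add; apply Hcc; lia).
  (* Here [n] is an inner vertex. The outer vertices lie among the [i] vertices before [i] and the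
     members of [c] after [j]. *)
  assert (Houter : forall j, (j < n)%nat -> c j = true ->
    outer_count col (S n) i j <= Z.of_nat i + Z.of_nat p - 1 - Z.of_nat (count j c)).
  { intros j Hj Hc.
    assert (Hij : (i < j)%nat) by (unfold c in Hc; lia).
    assert (H : Z.of_nat (count (S j) c) = Z.of_nat (count j c) + 1)
      by (cbn [count]; rewrite Hc; cbn [Nat.b2n]; lia).
    replace (Z.of_nat i + Z.of_nat p - 1 - Z.of_nat (count j c))
      with (Z.of_nat i * 1 + Z.of_nat p + (-1) * Z.of_nat (count (S j) c)) by lia.
    unfold p; rewrite !count_zsum, <- (zsum_const i 1).
    rewrite <- (zsum_restrict n i), <- (zsum_restrict n (S j)) by lia.
    rewrite <- zsum_mul, <- !zsum_add; unfold outer_count; cbn [zsum].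
    replace (outer_ind col i j n) with 0; [rewrite Z.add_0_r; apply zsum_le|].
    - intros r Hr; unfold outer_ind, outer, c in *.
      destruct (Nat.ltb_spec r i), (Nat.leb_spec r j), (Nat.ltb_spec r (S j)),
        (Nat.ltb_spec i r), (Nat.ltb_spec i j), (Nat.eqb_spec r i), (Nat.eqb_spec r j);
        try lia; cbn [negb andb] in *;
        destruct (col i n), (col i j), (col i r); cbn in *; try lia; try discriminate;
        destruct (col r j); cbn; lia.
    - unfold outer_ind, outer, c in *; decide_comparisons.
      destruct (col i n), (col i j); cbn in *; try reflexivity;
        rewrite andb_false_r in Hc; discriminate. }
  (* Here [n] is an outer vertex. The inner vertices lie among those before [i], those between [i]
     and [j], which belong to [c] or [c'], and the members of [c] after [j]. *)
  assert (Hinner : forall j, (j < n)%nat -> c' j = true ->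
    inner_count col (S n) i j <= Z.of_nat i + Z.of_nat p + Z.of_nat (count j c')).
  { intros j Hj Hc.
    assert (Hij : (i < j)%nat) by (unfold c' in Hc; lia).
    replace (Z.of_nat i + Z.of_nat p + Z.of_nat (count j c'))
      with (Z.of_nat i * 1 + Z.of_nat p + Z.of_nat (count j c')) by lia.
    unfold p; rewrite !count_zsum, <- (zsum_const i 1).
    rewrite <- (zsum_restrict n i), <- (zsum_restrict n j) by lia.
    rewrite <- !zsum_add; unfold inner_count; cbn [zsum].
    replace (inner_ind col i j n) with 0; [rewrite Z.add_0_r; apply zsum_le|].
    - intros r Hr; unfold inner_ind, outer, c, c' in *.
      destruct (Nat.ltb_spec r i), (Nat.leb_spec r j), (Nat.ltb_spec r j),
        (Nat.ltb_spec i r), (Nat.ltb_spec i j), (Nat.eqb_spec r i), (Nat.eqb_spec r j);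
        try lia; cbn [negb andb] in *;
        destruct (col i n), (col i j), (col i r); cbn in *; try lia; try discriminate;
        destruct (col r j); cbn; lia.
    - unfold inner_ind, outer, c' in *; decide_comparisons.
      destruct (col i n), (col i j); cbn in *; try reflexivity;
        rewrite andb_false_r in Hc; discriminate. }
  transitivity (zsum (p + q) (fun t => Z.b2z (t <? k - i)%nat * 1)).
  { rewrite zsum_restrict, zsum_const by lia; lia. }
  (* Read backwards, [c] supplies the bounds [i, ..., i + p - 1]; [c'] continues with
     [i + p, ..., n - 2]. *)
  rewrite zsum_app, <- (zsum_reverse p); unfold p at 1, q.
  rewrite <- (zsum_rank n c), <- (zsum_rank n c'), <- zsum_add.
  apply zsum_le; intros j Hj.
  specialize (Houter j Hj); specialize (Hinner j Hj).
  unfold invariant_ind.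
  destruct (Nat.ltb_spec i j) as [Hij|Hij].
  2: { unfold c, c'; replace (i <? j)%nat with false by lia; cbn; lia. }
  assert (Ho : outer col i j n = eqb (col i n) (col i j))
    by (unfold outer; decide_comparisons; reflexivity).
  rewrite Ho; unfold c at 1 in Houter; unfold c at 1; unfold c' at 1 in Hinner;
    unfold c' at 1; replace (i <? j)%nat with true in * by lia; cbn [andb] in *.
  destruct (eqb (col i n) (col i j)); cbn [negb andb Z.b2z] in *.
  - specialize (Hinner eq_refl); lia.
  - specialize (Houter eq_refl); fold p in Houter; fold p; lia.
Qed.

Lemma invariants_lower_bound col k n :
  (k < n)%nat ->
  Z.of_nat k * (Z.of_nat k + 1) <= 2 * zsum2 n (invariant_ind col k n).
Proof.
  intros Hk; rewrite zsum2_rectangle.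
  pose proof (zsum_descending k (Z.of_nat k)) as HD.
  rewrite <- (zsum_restrict n) in HD by lia.
  assert (H : zsum n (fun i => Z.b2z (i <? k)%nat * (Z.of_nat k - Z.of_nat i)) <=
    zsum n (fun i => zsum n (fun j => Z.b2z (i <? j)%nat * invariant_ind col k n i j))).
  { apply zsum_le; intros i Hi; destruct (Nat.ltb_spec i k); cbn [Z.b2z].
    - rewrite Z.mul_1_l; apply row_invariants; lia.
    - rewrite Z.mul_0_l, <- (zsum_zero n (fun _ => 0)) by auto.
      apply zsum_le; intros j Hj; unfold invariant_ind; lia. }
  lia.
Qed.

(** Induction on [k], deleting the last vertex at the same time. When threshold and vertex set both
    grow by one, the side gaining the vertex keeps its weight, and the other gains one if it is
    below the new threshold. The increments are [2 C(k+2,2)] from the last vertex and at least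
    [C(k+2,2)] from [invariant_ind], which carry [3 C(k+2,3)] to [3 C(k+3,3)]. *)
Lemma total_weight_lower_bound col k n :
  (k + 2 <= n)%nat ->
  Z.of_nat k * (Z.of_nat k + 1) * (Z.of_nat k + 2) <= 2 * total_weight col k n.
Proof.
  revert n; induction k as [|k IH]; intros n Hn.
  - unfold total_weight; rewrite (zsum2_ext n _ (fun _ _ => 0 * 0)), zsum2_mul; [lia|].
    intros i j _ _.
    pose proof (outer_count_ge0 col n i j); pose proof (inner_count_ge0 col n i j).
    unfold weight; lia.
  - destruct n as [|n]; [lia|]; specialize (IH n ltac:(lia)).
    unfold total_weight in *; rewrite zsum2_S, last_column_weight by lia.
    rewrite (zsum2_ext n _ (fun i j => (weight k (outer_count col n i j) +
       weight k (inner_count col n i j)) + invariant_ind col (S k) n i j)).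
    2: { intros i j Hij Hj.
         pose proof (outer_count_ge0 col n i j); pose proof (inner_count_ge0 col n i j).
         unfold invariant_ind.
         change (outer_count col (S n) i j) with (outer_count col n i j + outer_ind col i j n).
         change (inner_count col (S n) i j) with (inner_count col n i j + inner_ind col i j n).
         unfold weight, outer_ind, inner_ind.
         replace (n =? i)%nat with false by lia; replace (n =? j)%nat with false by lia.
         destruct (outer col i j n); cbn [negb andb Z.b2z]; lia. }
    rewrite zsum2_add.
    pose proof (invariants_lower_bound col (S k) n ltac:(lia)).
    rewrite !Nat2Z.inj_succ in *; nia.
Qed.


(** * Products of side counts expressed by truncations *)

Lemma zsum_weights (K : nat) (x : Z) :
  0 <= x ->
  2 * zsum K (fun k => weight k x) =
  Z.max 0 (Z.of_nat K - 1 - x) * Z.max 0 (Z.of_nat K - x).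
Proof.
  intros Hx; induction K as [|K IH]; cbn [zsum].
  - rewrite !Z.max_l by lia; lia.
  - rewrite Z.mul_add_distr_l, IH; unfold weight.
    destruct (Z.max_spec 0 (Z.of_nat K - 1 - x)) as [[? ->]|[? ->]],
      (Z.max_spec 0 (Z.of_nat K - x)) as [[? ->]|[? ->]],
      (Z.max_spec 0 (Z.of_nat (S K) - 1 - x)) as [[? ->]|[? ->]],
      (Z.max_spec 0 (Z.of_nat (S K) - x)) as [[? ->]|[? ->]]; nia.
Qed.

(** If the smaller number is [M - d], the product is [M^2 - d^2]. Only the smaller one has nonzero
    weights here, and [d^2 = d (d - 1) + d]. *)
Lemma mul_even_weights (M : nat) (x y : Z) :
  0 <= x -> 0 <= y -> x + y = 2 * Z.of_nat M ->
  x * y + (2 * zsum M (fun k => weight k x + weight k y) +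
           (weight M x + weight M y)) = Z.of_nat M * Z.of_nat M.
Proof.
  intros Hx Hy Hxy; rewrite zsum_add, Z.mul_add_distr_l, !zsum_weights by lia.
  unfold weight; replace y with (2 * Z.of_nat M - x) in * by lia.
  destruct (Z.le_gt_cases x (Z.of_nat M)).
  - rewrite (Z.max_l 0 (Z.of_nat M - (2 * Z.of_nat M - x))) by lia.
    rewrite (Z.max_r 0 (Z.of_nat M - x)) by lia.
    destruct (Z.max_spec 0 (Z.of_nat M - 1 - x)) as [[? ->]|[? ->]]; nia.
  - rewrite (Z.max_r 0 (Z.of_nat M - (2 * Z.of_nat M - x))) by lia.
    rewrite (Z.max_l 0 (Z.of_nat M - x)) by lia.
    destruct (Z.max_spec 0 (Z.of_nat M - 1 - (2 * Z.of_nat M - x))) as [[? ->]|[? ->]]; nia.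
Qed.

(** With [M - d] and [M + 1 + d], the product is [M (M + 1) - d (d + 1)]. *)
Lemma mul_odd_weights (M : nat) (x y : Z) :
  0 <= x -> 0 <= y -> x + y = 2 * Z.of_nat M + 1 ->
  x * y + 2 * zsum (S M) (fun k => weight k x + weight k y) =
  Z.of_nat M * (Z.of_nat M + 1).
Proof.
  intros Hx Hy Hxy; rewrite zsum_add, Z.mul_add_distr_l, !zsum_weights by lia.
  replace y with (2 * Z.of_nat M + 1 - x) in * by lia.
  destruct (Z.le_gt_cases x (Z.of_nat M)).
  - rewrite (Z.max_l 0 (Z.of_nat (S M) - 1 - (2 * Z.of_nat M + 1 - x))) by lia.
    rewrite (Z.max_r 0 (Z.of_nat (S M) - 1 - x)), (Z.max_r 0 (Z.of_nat (S M) - x)) by lia.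
    nia.
  - rewrite (Z.max_l 0 (Z.of_nat (S M) - 1 - x)) by lia.
    rewrite (Z.max_r 0 (Z.of_nat (S M) - 1 - (2 * Z.of_nat M + 1 - x))),
      (Z.max_r 0 (Z.of_nat (S M) - (2 * Z.of_nat M + 1 - x))) by lia.
    nia.
Qed.

Lemma zsum_rising3 (K : nat) :
  4 * zsum K (fun k => Z.of_nat k * (Z.of_nat k + 1) * (Z.of_nat k + 2)) =
  (Z.of_nat K - 1) * Z.of_nat K * (Z.of_nat K + 1) * (Z.of_nat K + 2).
Proof. induction K as [|K IH]; cbn [zsum]; [reflexivity|]; rewrite Nat2Z.inj_succ; nia. Qed.

Lemma zsum_total_weight_lower_bound col K n :
  (K + 1 <= n)%nat ->
  (Z.of_nat K - 1) * Z.of_nat K * (Z.of_nat K + 1) * (Z.of_nat K + 2) <=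
  8 * zsum K (fun k => total_weight col k n).
Proof.
  intros HK; rewrite <- zsum_rising3.
  assert (zsum K (fun k => Z.of_nat k * (Z.of_nat k + 1) * (Z.of_nat k + 2)) <=
          zsum K (fun k => 2 * total_weight col k n)) as H.
  { apply zsum_le; intros k Hk; apply total_weight_lower_bound; lia. }
  rewrite zsum_mul in H; lia.
Qed.

(** Four times the claimed crossing number, which keeps the counting in the integers. *)
Definition four_Z (n : nat) : Z :=
  (Z.of_nat n - 0) / 2 * ((Z.of_nat n - 1) / 2) *
  ((Z.of_nat n - 2) / 2) * ((Z.of_nat n - 3) / 2).

Lemma half_eq (a q r : Z) : 0 <= r < 2 -> a = 2 * q + r -> a / 2 = q.
Proof. intros Hr ->; symmetry; apply Z.div_unique with r; lia. Qed.

Lemma four_Z_even (M : nat) :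
  four_Z (2 * M + 2) =
  (Z.of_nat M + 1) * Z.of_nat M * Z.of_nat M * (Z.of_nat M - 1).
Proof.
  unfold four_Z; rewrite (half_eq _ (Z.of_nat M + 1) 0), (half_eq _ (Z.of_nat M) 1),
    (half_eq _ (Z.of_nat M) 0), (half_eq _ (Z.of_nat M - 1) 1) by lia; lia.
Qed.

Lemma four_Z_odd (M : nat) :
  four_Z (2 * M + 3) =
  (Z.of_nat M + 1) * (Z.of_nat M + 1) * Z.of_nat M * Z.of_nat M.
Proof.
  unfold four_Z; rewrite (half_eq _ (Z.of_nat M + 1) 1), (half_eq _ (Z.of_nat M + 1) 0),
    (half_eq _ (Z.of_nat M) 1), (half_eq _ (Z.of_nat M) 0) by lia; lia.
Qed.

(** By [mono_crossings_identity] it suffices to bound the sum of the side products from above. These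
    are constants minus weights, and the total weights are bounded from below. *)
Lemma mono_crossings_lower_bound col n :
  (0 < n)%nat -> four_Z n <= 4 * mono_crossings col n.
Proof.
  intros Hn.
  pose proof (mono_crossings_identity col n) as HX.
  pose proof (zsum4_one n) as H4; pose proof (zsum2_one n) as H2.
  (* The remaining cases are [2 * M + 2] and [2 * M + 3], so that the sides of an edge share [2 * M]
     or [2 * M + 1] vertices. *)
  destruct (Nat.eq_dec n 1) as [->|Hn1]; [cbn; lia|].
  assert (Hsum : forall K, zsum2 n (fun i j => zsum K (fun k =>
      weight k (outer_count col n i j) + weight k (inner_count col n i j))) =
      zsum K (fun k => total_weight col k n))
    by (intros K; rewrite <- (zsum_zsum2_exchange K n
          (fun k i j => weight k (outer_count col n i j) + weight k (inner_count col n i j)));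
        reflexivity).
  destruct (Nat.Even_or_Odd n) as [[m Hm]|[m Hm]].
  - destruct m as [|M]; [lia|].
    assert (HE : zsum2 n (fun i j => outer_count col n i j * inner_count col n i j) +
      (2 * zsum M (fun k => total_weight col k n) + total_weight col M n) =
      Z.of_nat M * Z.of_nat M * zsum2 n (fun _ _ => 1)).
    { rewrite <- Hsum; unfold total_weight at 1.
      rewrite <- !zsum2_mul, <- !zsum2_add; apply zsum2_ext; intros i j Hij Hj.
      rewrite Z.mul_1_r; apply mul_even_weights.
      - apply outer_count_ge0.
      - apply inner_count_ge0.
      - rewrite outer_inner_count by lia; lia. }
    pose proof (zsum_total_weight_lower_bound col M n ltac:(lia)) as HT.
    pose proof (total_weight_lower_bound col M n ltac:(lia)) as HT'.
    replace n with (2 * M + 2)%nat at 1 by lia; rewrite four_Z_even.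
    replace (Z.of_nat n) with (2 * Z.of_nat M + 2) in * by lia; nia.
  - destruct m as [|M]; [lia|].
    assert (HE : zsum2 n (fun i j => outer_count col n i j * inner_count col n i j) +
      2 * zsum (S M) (fun k => total_weight col k n) =
      Z.of_nat M * (Z.of_nat M + 1) * zsum2 n (fun _ _ => 1)).
    { rewrite <- Hsum.
      rewrite <- !zsum2_mul, <- !zsum2_add; apply zsum2_ext; intros i j Hij Hj.
      rewrite Z.mul_1_r; apply mul_odd_weights.
      - apply outer_count_ge0.
      - apply inner_count_ge0.
      - rewrite outer_inner_count by lia; lia. }
    pose proof (zsum_total_weight_lower_bound col (S M) n ltac:(lia)) as HT.
    replace n with (2 * M + 3)%nat at 1 by lia; rewrite four_Z_odd.
    replace (Z.of_nat (S M)) with (Z.of_nat M + 1) in * by lia.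
    replace (Z.of_nat n) with (2 * Z.of_nat M + 3) in * by lia; nia.
Qed.


(** * An optimal colouring *)

Lemma zsum2_app (p q : nat) (f : nat -> nat -> Z) :
  zsum2 (p + q) f =
  zsum2 p f + zsum q (fun j => zsum p (fun i => f i (p + j)%nat)) +
  zsum2 q (fun i j => f (p + i)%nat (p + j)%nat).
Proof.
  unfold zsum2 at 1; rewrite zsum_app.
  rewrite (zsum_ext q _ (fun j => zsum p (fun i => f i (p + j)%nat) +
    zsum j (fun i => f (p + i)%nat (p + j)%nat))) by (intros; apply zsum_app).
  rewrite zsum_add; unfold zsum2; lia.
Qed.

Lemma zsum2_S_l (n : nat) (f : nat -> nat -> Z) :
  zsum2 (S n) f =
  zsum n (fun j => f O (S j)) + zsum2 n (fun i j => f (S i) (S j)).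
Proof.
  unfold zsum2; rewrite zsum_S_l, <- zsum_add, Z.add_0_l.
  apply zsum_ext; intros; apply zsum_S_l.
Qed.

Lemma zsum_cubic (n : nat) (c0 c1 c2 c3 : Z) :
  let N := Z.of_nat n in
  12 * zsum n (fun i => let x := Z.of_nat i in c0 + c1 * x + c2 * (x * x) + c3 * (x * x * x)) =
  12 * c0 * N + 6 * c1 * (N * (N - 1)) + 2 * c2 * ((N - 1) * N * (2 * N - 1)) +
  3 * c3 * (N * N * ((N - 1) * (N - 1))).
Proof.
  cbv zeta; induction n as [|n IH]; cbn [zsum]; [ring|].
  rewrite Z.mul_add_distr_l, IH, Nat2Z.inj_succ; ring.
Qed.

Lemma zsum2_quadratic (n : nat) (c0 c1 c2 : Z) :
  let N := Z.of_nat n in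
  12 * zsum2 n (fun i j => let d := Z.of_nat j - Z.of_nat i in c0 + c1 * d + c2 * (d * d)) =
  6 * c0 * (N * (N - 1)) + 2 * c1 * ((N - 1) * N * (N + 1)) +
  c2 * (N * N * (N * N - 1)).
Proof.
  cbv zeta; induction n as [|n IH]; [cbn; ring|].
  rewrite zsum2_S, Z.mul_add_distr_l, IH.
  set (N := Z.of_nat n).
  rewrite (zsum_ext n _ (fun i => let x := Z.of_nat i in
    (c0 + c1 * N + c2 * (N * N)) + (- c1 - 2 * c2 * N) * x + c2 * (x * x) + 0 * (x * x * x)))
    by (intros; cbv zeta; fold N; ring).
  rewrite zsum_cubic, Nat2Z.inj_succ; fold N; ring.
Qed.

(* For [e = 0] and [2 m] vertices on a circle, [colour] gives the same page to
   [m] consecutive classes of parallel chords; [e = 1] deletes the vertex [0]. *)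
Definition colour (m e i j : nat) : bool :=
  let s := (i + j + 2 * e)%nat in
  (s <? m)%nat || ((2 * m <=? s) && (s <? 3 * m))%nat.

Lemma outer_count_intervals col n i j l1 h1 l2 h2 l3 h3 :
  (l1 <= h1)%nat -> (h1 <= n)%nat -> (l2 <= h2)%nat -> (h2 <= n)%nat ->
  (l3 <= h3)%nat -> (h3 <= n)%nat ->
  (forall r, (r < n)%nat -> outer_ind col i j r =
     Z.b2z ((l1 <=? r) && (r <? h1))%nat + Z.b2z ((l2 <=? r) && (r <? h2))%nat +
     Z.b2z ((l3 <=? r) && (r <? h3))%nat) ->
  outer_count col n i j =
  Z.of_nat h1 - Z.of_nat l1 + (Z.of_nat h2 - Z.of_nat l2) + (Z.of_nat h3 - Z.of_nat l3).
Proof.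
  intros ? ? ? ? ? ? H; unfold outer_count; rewrite (zsum_ext n _ _ H).
  rewrite !zsum_add, !zsum_interval by lia; lia.
Qed.

Ltac outer_ind_case :=
  intros; unfold outer_ind, outer, colour; cbv zeta;
  repeat match goal with
  | |- context [if ?b then _ else _] => destruct b eqn:?
  end; lia.

(** With one end fixed, the colour changes only where the index sum passes a multiple of [m], so the
    outer side is a union of at most three intervals. The cases say in which half of the circle each
    end lies. A bound such as [2 * m - (i + e) - e] is the vertex [r] at which [i + r + 2 * e]
    reaches [2 * m]. *)
Lemma colour_outer_count (m e i j : nat) :
  (e <= 1)%nat -> (i < j)%nat -> (j + e < 2 * m)%nat ->
  outer_count (colour m e) (2 * m - e) i j =
  if (j + e <? m)%nat then
    if (i + j + 2 * e <? m)%nat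
    then Z.of_nat m - 1 - Z.of_nat e - (Z.of_nat j - Z.of_nat i)
    else Z.of_nat m - 1
  else if (i + e <? m)%nat then
    if (2 * m <=? i + j + 2 * e)%nat
    then Z.of_nat i + Z.of_nat e - 1
    else 2 * Z.of_nat m - 1 - 2 * Z.of_nat e - Z.of_nat j
  else
    if (i + j + 2 * e <? 3 * m)%nat
    then Z.of_nat m - 1
    else Z.of_nat m - 1 - Z.of_nat e - (Z.of_nat j - Z.of_nat i).
Proof.
  intros He Hij Hj.
  destruct (Nat.ltb_spec (j + e) m); [|destruct (Nat.ltb_spec (i + e) m)].
  - destruct (Nat.ltb_spec (i + j + 2 * e) m).
    + rewrite (outer_count_intervals _ _ i j (S j) (m - (i + e) - e)
        (2 * m - (i + e) - e) (2 * m - e) 0 i); try lia; outer_ind_case.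
    + rewrite (outer_count_intervals _ _ i j (S j) (2 * m - (i + e) - e)
        (m - (j + e) - e) i 0 0); try lia; outer_ind_case.
  - destruct (Nat.leb_spec (2 * m) (i + j + 2 * e)).
    + rewrite (outer_count_intervals _ _ i j (S j) (2 * m - e)
        (2 * m - (j + e) - e) i 0 0); try lia; outer_ind_case.
    + rewrite (outer_count_intervals _ _ i j (S j) (2 * m - (i + e) - e)
        0 i 0 0); try lia; outer_ind_case.
  - destruct (Nat.ltb_spec (i + j + 2 * e) (3 * m)).
    + rewrite (outer_count_intervals _ _ i j (S j) (3 * m - (i + e) - e)
        (2 * m - (j + e) - e) i 0 0); try lia; outer_ind_case.
    + rewrite (outer_count_intervals _ _ i j (S j) (2 * m - e)
        (3 * m - (j + e) - e) i 0 (2 * m - (j + e) - e)); try lia; outer_ind_case.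
Qed.


(** The terms [f i] are collected along [j] and the terms [g j] along [i]. The truncated difference
    [p - j] is the right count also for [j >= p]. *)
Lemma zsum_two_sided (p q : nat) (f g : nat -> Z) :
  (p <= q)%nat ->
  zsum q (fun j => zsum p (fun i => if (p <=? i + j)%nat then f i else g j)) =
  zsum p (fun i => (Z.of_nat q - Z.of_nat p + Z.of_nat i) * f i) +
  zsum q (fun j => Z.of_nat (p - j) * g j).
Proof.
  intros H.
  rewrite (zsum_ext q _ (fun j =>
    zsum p (fun i => Z.b2z (p <=? i + j)%nat * f i) +
    zsum p (fun i => Z.b2z (i <? p - j)%nat * g j))).
  2: { intros j Hj; rewrite <- zsum_add; apply zsum_ext; intros i Hi.
       destruct (Nat.leb_spec p (i + j)), (Nat.ltb_spec i (p - j));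
         cbn [Z.b2z]; lia. }
  rewrite zsum_add; f_equal.
  - rewrite (zsum_exchange q p (fun j i => Z.b2z (p <=? i + j)%nat * f i)).
    apply zsum_ext; intros i Hi; rewrite zsum_mul_r; f_equal.
    rewrite (zsum_ext q _ (fun j => Z.b2z ((p - i <=? j) && (j <? q))%nat))
      by (intros; f_equal; lia).
    rewrite zsum_interval by lia; lia.
  - apply zsum_ext; intros j Hj; rewrite zsum_restrict by lia; apply zsum_const.
Qed.

Lemma colour_side_products (m e : nat) :
  (e <= 1)%nat ->
  zsum2 (2 * m - e) (fun i j => outer_count (colour m e) (2 * m - e) i j *
                                inner_count (colour m e) (2 * m - e) i j) =
  zsum2 (2 * m - e) (fun i j => outer_count (colour m e) (2 * m - e) i j *
    (2 * Z.of_nat m - 2 - Z.of_nat e - outer_count (colour m e) (2 * m - e) i j)).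
Proof.
  intros He; apply zsum2_ext; intros i j Hij Hj.
  pose proof (outer_inner_count (colour m e) (2 * m - e) i j Hij Hj).
  f_equal; lia.
Qed.

Lemma colour_even_mono_crossings (M : nat) :
  4 * mono_crossings (colour (M + 1) 0) (2 * M + 2) = four_Z (2 * M + 2).
Proof.
  pose proof (mono_crossings_identity (colour (M + 1) 0) (2 * M + 2)) as HX.
  pose proof (zsum4_one (2 * M + 2)) as H4.
  rewrite four_Z_even.
  set (m := (M + 1)%nat) in *; set (A := Z.of_nat M) in *.
  replace (2 * M + 2)%nat with (2 * m - 0)%nat in * by lia.
  rewrite colour_side_products in HX by lia.
  assert (HS : zsum2 (2 * m - 0) (fun i j =>
    outer_count (colour m 0) (2 * m - 0) i j *
    (2 * Z.of_nat m - 2 - Z.of_nat 0 - outer_count (colour m 0) (2 * m - 0) i j)) =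
    zsum2 m (fun i j => let d := Z.of_nat j - Z.of_nat i in
       2 * (A * A) + 0 * d + (-1) * (d * d)) +
    zsum m (fun j => zsum m (fun i => if (m <=? i + j)%nat
       then (Z.of_nat i - 1) * (2 * A + 1 - Z.of_nat i)
       else (A - Z.of_nat j) * (A + Z.of_nat j)))).
  { replace (zsum2 (2 * m - 0)) with (zsum2 (m + m)) by (f_equal; lia).
    (* The vertices are cut into two halves of size [m]; pairs inside either half are summed
       together, pairs across separately. *)
    rewrite zsum2_app.
    rewrite <- Z.add_assoc, (Z.add_comm (zsum m _)), Z.add_assoc, <- zsum2_add.
    f_equal.
    (* Of a pair and its translate by [m], exactly one is split evenly, with product [A^2]; the
       other has product [A^2 - d^2]. *)
    - apply zsum2_ext; intros i j Hij Hj; cbv zeta.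
      rewrite !colour_outer_count by lia.
      destruct (Nat.ltb_spec (i + j + 2 * 0) m); decide_comparisons; nia.
    - apply zsum_ext; intros j Hj; apply zsum_ext; intros i Hi.
      rewrite !colour_outer_count by lia.
      destruct (Nat.leb_spec m (i + j)); decide_comparisons; nia. }
  rewrite HS in HX; clear HS.
  rewrite zsum_two_sided in HX by lia.
  pose proof (zsum2_quadratic m (2 * (A * A)) 0 (-1)) as HQ; cbv zeta in HQ, HX.
  rewrite (zsum_ext m _ (fun i => let x := Z.of_nat i in
    0 + (- (2 * A + 1)) * x + (2 * A + 2) * (x * x) + (-1) * (x * x * x))) in HX.
  2: { intros i Hi; cbv zeta; ring. }
  rewrite (zsum_ext m (fun j => Z.of_nat (m - j) * _) (fun i => let x := Z.of_nat i in
    (A + 1) * (A * A) + (- (A * A)) * x + (- (A + 1)) * (x * x) + 1 * (x * x * x))) in HX.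
  2: { intros i Hi; cbv zeta; replace (Z.of_nat (m - i)) with (A + 1 - Z.of_nat i) by lia.
       ring. }
  pose proof (zsum_cubic m 0 (- (2 * A + 1)) (2 * A + 2) (-1)) as C1.
  pose proof (zsum_cubic m ((A + 1) * (A * A)) (- (A * A)) (- (A + 1)) 1) as C2.
  cbv zeta in *.
  replace (Z.of_nat (2 * m - 0)) with (2 * A + 2) in * by lia.
  replace (Z.of_nat m) with (A + 1) in * by lia.
  nia.
Qed.

Lemma colour_odd_mono_crossings (M : nat) :
  4 * mono_crossings (colour (M + 1) 1) (2 * M + 1) = four_Z (2 * M + 1).
Proof.
  pose proof (mono_crossings_identity (colour (M + 1) 1) (2 * M + 1)) as HX.
  pose proof (zsum4_one (2 * M + 1)) as H4.
  assert (HZ : four_Z (2 * M + 1) = Z.of_nat M * Z.of_nat M * (Z.of_nat M - 1) * (Z.of_nat M - 1)).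
  { destruct M as [|M]; [reflexivity|].
    replace (2 * S M + 1)%nat with (2 * M + 3)%nat by lia.
    rewrite four_Z_odd, Nat2Z.inj_succ; ring. }
  rewrite HZ; clear HZ.
  set (m := (M + 1)%nat) in *; set (A := Z.of_nat M) in *.
  replace (2 * M + 1)%nat with (2 * m - 1)%nat in * by lia.
  rewrite colour_side_products in HX by lia.
  assert (HS : zsum2 (2 * m - 1) (fun i j =>
    outer_count (colour m 1) (2 * m - 1) i j *
    (2 * Z.of_nat m - 2 - Z.of_nat 1 - outer_count (colour m 1) (2 * m - 1) i j)) =
    zsum2 M (fun i j => let d := Z.of_nat j - Z.of_nat i in
       2 * (A * (A - 1)) + (-1) * d + (-1) * (d * d)) +
    zsum (S M) (fun j => zsum M (fun i => if (M <=? i + j)%nat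
       then Z.of_nat i * (2 * A - 1 - Z.of_nat i)
       else (A - 1 - Z.of_nat j) * (A + Z.of_nat j))) + A * (A * (A - 1))).
  { replace (zsum2 (2 * m - 1)) with (zsum2 (M + S M)) by (f_equal; lia).
    (* The halves have sizes [M] and [M + 1]. Splitting off the first vertex of the second half
       restores the pairing by translation; its [M] edges inside that half are all split as evenly
       as possible. *)
    rewrite zsum2_app, zsum2_S_l.
    match goal with |- ?a + ?b + (?c + ?d) = ?x + ?y + ?z =>
      enough (a + d = x /\ c = z /\ b = y) by lia end.
    rewrite <- zsum2_add; repeat split.
    - apply zsum2_ext; intros i j Hij Hj; cbv zeta.
      rewrite !colour_outer_count by lia.
      destruct (Nat.ltb_spec (i + j + 2 * 1) m); decide_comparisons; nia.
    - rewrite <- (zsum_const M).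
      apply zsum_ext; intros j Hj.
      rewrite !colour_outer_count by lia.
      decide_comparisons; nia.
    - apply zsum_ext; intros j Hj; apply zsum_ext; intros i Hi.
      rewrite !colour_outer_count by lia.
      destruct (Nat.leb_spec M (i + j)); decide_comparisons; nia. }
  rewrite HS in HX; clear HS.
  rewrite zsum_two_sided in HX by lia.
  pose proof (zsum2_quadratic M (2 * (A * (A - 1))) (-1) (-1)) as HQ; cbv zeta in HQ, HX.
  rewrite (zsum_ext M _ (fun i => let x := Z.of_nat i in
    0 + (2 * A - 1) * x + (2 * A - 2) * (x * x) + (-1) * (x * x * x))) in HX.
  2: { intros i Hi; cbv zeta; rewrite Nat2Z.inj_succ; fold A; ring. }
  rewrite (zsum_ext (S M) _ (fun i => let x := Z.of_nat i in
    A * A * (A - 1) + (- (A * A)) * x + (1 - A) * (x * x) + 1 * (x * x * x))) in HX.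
  2: { intros i Hi; cbv zeta; replace (Z.of_nat (M - i)) with (A - Z.of_nat i) by lia.
       ring. }
  pose proof (zsum_cubic M 0 (2 * A - 1) (2 * A - 2) (-1)) as C1.
  pose proof (zsum_cubic (S M) (A * A * (A - 1)) (- (A * A)) (1 - A) 1) as C2.
  cbv zeta in *.
  replace (Z.of_nat (2 * m - 1)) with (2 * A + 1) in * by lia.
  replace (Z.of_nat (S M)) with (A + 1) in * by lia.
  fold A in HQ, C1; nia.
Qed.


(** * Interleaved paths in a half-plane meet *)

Fixpoint bxor (n : nat) (f : nat -> bool) : bool :=
  match n with O => false | S m => xorb (bxor m f) (f m) end.

(* Read [B] as the sign of [y] and [P] as the sign of [x] at the vertices of a
   grid: the parity of the crossings of the positive [x]-axis is the same along
   all vertical grid lines. *)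
Lemma grid_parity (N : nat) (B P : nat -> nat -> bool) :
  (forall i j, (i < N)%nat -> (j < N)%nat ->
     (B (S i) j = B i j /\ B i (S j) = B i j /\ B (S i) (S j) = B i j) \/
     (P (S i) j = P i j /\ P i (S j) = P i j /\ P (S i) (S j) = P i j)) ->
  (forall i, (i <= N)%nat -> B i O = true) ->
  (forall i, (i <= N)%nat -> B i N = true) ->
  bxor N (fun j => xorb (B N j) (B N (S j)) && P N j) =
  bxor N (fun j => xorb (B O j) (B O (S j)) && P O j).
Proof.
  intros Hcell Hbot Htop.
  set (V := fun i m => bxor m (fun j => xorb (B i j) (B i (S j)) && P i j)).
  (* Around a cell the crossings cancel: there are none if [B] is constant on it, and an even number
     with the same [P] if [P] is constant. *)
  assert (strip : forall i m, (i < N)%nat -> (m <= N)%nat ->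
    xorb (V (S i) m) (V i m) =
    xorb (xorb (B i O) (B (S i) O) && P i O) (xorb (B i m) (B (S i) m) && P i m)).
  { intros i m Hi; induction m as [|m IH]; intros Hm.
    - symmetry; apply xorb_nilpotent.
    - specialize (IH ltac:(lia)); unfold V in *; cbn [bxor].
      set (X := bxor m (fun j => xorb (B (S i) j) _ && _)) in *.
      set (Y := bxor m (fun j => xorb (B i j) _ && _)) in *.
      set (H0 := xorb (B i O) (B (S i) O) && P i O) in *.
      replace X with (xorb (xorb X Y) Y) by (destruct X, Y; reflexivity).
      rewrite IH; clearbody X Y H0; clear IH.
      destruct (Hcell i m Hi ltac:(lia)) as [[E1 [E2 E3]]|[E1 [E2 E3]]].
      + rewrite E3, E2, E1, !xorb_nilpotent; destruct Y, H0; reflexivity.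
      + rewrite E1, E2; destruct (P i m), Y, H0, (B i m), (B (S i) m), (B i (S m)),
          (B (S i) (S m)); reflexivity. }
  assert (step : forall i, (i <= N)%nat -> V i N = V O N).
  { induction i as [|i IH]; intros Hi; [reflexivity|].
    rewrite <- IH by lia; specialize (strip i N ltac:(lia) ltac:(lia)).
    rewrite !Hbot, !Htop in strip by lia.
    destruct (V (S i) N), (V i N); try reflexivity; discriminate strip. }
  apply (step N); lia.
Qed.

(** Where [p] changes, [b] is false at both ends. Each term is therefore the change of [b && p], and
    the sum telescopes. *)
Lemma side_parity (N : nat) (b p : nat -> bool) :
  (forall j, (j < N)%nat -> p (S j) = p j \/ (b j = false /\ b (S j) = false)) ->
  bxor N (fun j => xorb (b j) (b (S j)) && p j) =
  xorb (b O && p O) (b N && p N).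
Proof.
  induction N as [|N IH]; intros H; [symmetry; apply xorb_nilpotent|].
  cbn [bxor]; rewrite IH by (intros; apply H; lia).
  destruct (H N ltac:(lia)) as [E|[E1 E2]]; [rewrite E|rewrite E1, E2];
    destruct (b O), (p O), (p N); cbn; try reflexivity; destruct (b N), (b (S N)); reflexivity.
Qed.

Open Scope R_scope.

(** On [Q] the difference [f s - g t] stays in one open half-plane bounded by a coordinate axis, so
    one of its two signs is constant there. *)
Definition signed_cell (f g : R -> point) (Q : R -> R -> Prop) : Prop :=
  (forall s t, Q s t -> fst (f s) < fst (g t)) \/
  (forall s t, Q s t -> fst (g t) < fst (f s)) \/
  (forall s t, Q s t -> snd (f s) < snd (g t)) \/
  (forall s t, Q s t -> snd (g t) < snd (f s)).

Lemma local_sign (f g : R -> point) (u v : R) :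
  cont_on01 f -> cont_on01 g -> in01 u -> in01 v -> f u <> g v ->
  exists delta : posreal, signed_cell f g (fun s t =>
    in01 s /\ in01 t /\ Rabs (s - u) < 2 * delta /\ Rabs (t - v) < 2 * delta).
Proof.
  intros Hf Hg Hu Hv Hne.
  assert (pick : forall eps, 0 < eps -> exists delta : posreal, forall s t,
    in01 s /\ in01 t /\ Rabs (s - u) < 2 * delta /\ Rabs (t - v) < 2 * delta ->
    (Rabs (fst (f s) - fst (f u)) < eps /\ Rabs (snd (f s) - snd (f u)) < eps) /\
    (Rabs (fst (g t) - fst (g v)) < eps /\ Rabs (snd (g t) - snd (g v)) < eps)).
  { intros eps Heps.
    destruct (Hf u Hu eps Heps) as [d1 [Hd1 H1]].
    destruct (Hg v Hv eps Heps) as [d2 [Hd2 H2]].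
    (* Halved because the statement uses the radius [2 * delta], which leaves room for the covering
       argument. *)
    assert (Hd : 0 < Rmin d1 d2 / 2) by (pose proof (Rmin_pos d1 d2 Hd1 Hd2); lra).
    exists (mkposreal _ Hd); simpl; intros s t [Hs [Ht [Hsu Htv]]].
    pose proof (Rmin_l d1 d2); pose proof (Rmin_r d1 d2).
    split; [apply H1|apply H2]; auto; lra. }
  destruct (Req_dec (fst (f u)) (fst (g v))) as [E|E].
  - destruct (Req_dec (snd (f u)) (snd (g v))) as [E'|E'].
    + exfalso; apply Hne; destruct (f u), (g v); simpl in *; congruence.
    (* Moving each value by less than half the gap cannot reverse their order. *)
    + destruct (pick (Rabs (snd (f u) - snd (g v)) / 2)) as [delta H].
      { assert (0 < Rabs (snd (f u) - snd (g v))) by (apply Rabs_pos_lt; lra); lra. }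
      exists delta; unfold signed_cell.
      destruct (Rdichotomy _ _ E'); [right; right; left|right; right; right];
        intros s t Hst; destruct (H s t Hst) as [[_ Ha] [_ Hb]];
        revert Ha Hb; unfold Rabs; repeat destruct Rcase_abs; lra.
  - destruct (pick (Rabs (fst (f u) - fst (g v)) / 2)) as [delta H].
    { assert (0 < Rabs (fst (f u) - fst (g v))) by (apply Rabs_pos_lt; lra); lra. }
    exists delta; unfold signed_cell.
    destruct (Rdichotomy _ _ E); [left|right; left];
      intros s t Hst; destruct (H s t Hst) as [[Ha _] [Hb _]];
      revert Ha Hb; unfold Rabs; repeat destruct Rcase_abs; lra.
Qed.

(** A Lebesgue number for the cover of the unit square by the neighbourhoods of [local_sign]. *)
Lemma uniform_sign (f g : R -> point) :
  cont_on01 f -> cont_on01 g ->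
  (forall s t, in01 s -> in01 t -> f s <> g t) ->
  exists d, 0 < d /\ forall x y, in01 x -> in01 y ->
    signed_cell f g (fun s t =>
      in01 s /\ in01 t /\ Rabs (s - x) < d /\ Rabs (t - y) < d).
Proof.
  intros Hf Hg Hne.
  assert (Hex : forall u v, exists delta : posreal, in01 u -> in01 v ->
    signed_cell f g (fun s t =>
      in01 s /\ in01 t /\ Rabs (s - u) < 2 * delta /\ Rabs (t - v) < 2 * delta)).
  { intros u v; destruct (classic (in01 u /\ in01 v)) as [[Hu Hv]|H].
    - destruct (local_sign f g u v Hf Hg Hu Hv (Hne u v Hu Hv)) as [delta Hd].
      exists delta; auto.
    - exists (mkposreal 1 Rlt_0_1); tauto. }
  set (delta := fun u v => proj1_sig (constructive_indefinite_description _ (Hex u v))).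
  assert (Hdelta : forall u v, in01 u -> in01 v -> signed_cell f g (fun s t =>
    in01 s /\ in01 t /\ Rabs (s - u) < 2 * delta u v /\ Rabs (t - v) < 2 * delta u v))
    by (intros u v; unfold delta; apply proj2_sig).
  (* Each [(x, y)] is within [delta u v] of some [(u, v)] with [d <= delta u v]; hence its
     [d]-neighbourhood lies within [2 * delta u v] of that point. *)
  destruct (compactness_value_2d 0 1 0 1 delta) as [d Hd].
  exists d; split; [apply cond_pos|]; intros x y Hx Hy.
  destruct (NNPP _ (Hd x y Hx Hy)) as [u [v [Hu [Hv [Hxu [Hyv Hle]]]]]].
  assert (sub : forall s t,
    in01 s /\ in01 t /\ Rabs (s - x) < d /\ Rabs (t - y) < d ->
    in01 s /\ in01 t /\ Rabs (s - u) < 2 * delta u v /\ Rabs (t - v) < 2 * delta u v).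
  { intros s t [Hs [Ht [Hsx Hty]]]; repeat split; try apply Hs; try apply Ht;
      revert Hsx Hty Hxu Hyv; unfold Rabs; repeat destruct Rcase_abs; lra. }
  unfold signed_cell in *; destruct (Hdelta u v Hu Hv) as [H|[H|[H|H]]];
    [left|right; left|right; right; left|right; right; right];
    intros s t Hst; apply H, sub, Hst.
Qed.

Lemma interleaved_paths_meet (f g : R -> point) (a b c d : R) :
  cont_on01 f -> cont_on01 g ->
  (forall t, in01 t -> 0 <= snd (f t)) -> (forall t, in01 t -> 0 <= snd (g t)) ->
  f 0 = (a, 0) -> f 1 = (c, 0) -> g 0 = (b, 0) -> g 1 = (d, 0) ->
  a < b -> b < c -> c < d ->
  exists s t, in01 s /\ in01 t /\ f s = g t.
Proof.
  intros Hf Hg Pf Pg f0 f1 g0 g1 Hab Hbc Hcd; apply NNPP; intros Hno.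
  destruct (uniform_sign f g Hf Hg) as [eps [Heps Hsign]].
  { intros s t Hs Ht E; apply Hno; exists s, t; auto. }
  destruct (archimed_cor1 eps Heps) as [N [HN HN0]].
  assert (Npos : 0 < INR N) by (apply lt_0_INR; lia).
  set (h := fun i => INR i / INR N).
  assert (h01 : forall i, (i <= N)%nat -> in01 (h i)).
  { intros i Hi; unfold h, in01; pose proof (pos_INR i).
    pose proof (le_INR i N Hi); split.
    - apply Rmult_le_pos; [lra|left; apply Rinv_0_lt_compat; lra].
    - apply Rmult_le_reg_r with (INR N); [lra|].
      unfold Rdiv; rewrite Rmult_assoc, Rinv_l by lra; lra. }
  assert (h0 : h O = 0) by (unfold h; simpl; field; lra).
  assert (hN : h N = 1) by (unfold h; field; lra).
  assert (hS : forall i, h (S i) - h i = / INR N)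
    by (intros i; unfold h; rewrite S_INR; field; lra).
  assert (invpos : 0 < / INR N) by (apply Rinv_0_lt_compat; lra).
  assert (near : forall i i', (i' = i \/ i' = S i) -> Rabs (h i' - h i) < eps).
  { intros i i' [->| ->].
    - replace (h i - h i) with 0 by ring; rewrite Rabs_R0; lra.
    - rewrite hS, Rabs_right; lra. }
  (* The comparison is not strict, so [B] holds whenever [g] is at an end on the spine, even if [f]
     is on the spine too. *)
  set (B := fun i j => if Rle_dec (snd (g (h j))) (snd (f (h i))) then true else false).
  set (P := fun i j => if Rlt_dec (fst (g (h j))) (fst (f (h i))) then true else false).
  assert (cell : forall i j, (i < N)%nat -> (j < N)%nat ->
    signed_cell f g (fun s t => (s = h i \/ s = h (S i)) /\ (t = h j \/ t = h (S j)))).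
  { intros i j Hi Hj.
    assert (sub : forall s t, (s = h i \/ s = h (S i)) /\ (t = h j \/ t = h (S j)) ->
      in01 s /\ in01 t /\ Rabs (s - h i) < eps /\ Rabs (t - h j) < eps).
    { intros s t [[->| ->] [->| ->]]; (split; [apply h01; lia|split; [apply h01; lia|split;
        apply near; auto]]). }
    unfold signed_cell in *.
    destruct (Hsign (h i) (h j) (h01 i ltac:(lia)) (h01 j ltac:(lia))) as [H|[H|[H|H]]];
      [left|right; left|right; right; left|right; right; right];
      intros s t Hst; apply H, sub, Hst. }
  (* Here [f] is at an end, on the spine, and [g] is never below it. On a cell side, either the sign
     of the abscissa is constant or [g] is strictly above. *)
  assert (side : forall i, (i = O \/ i = N) -> forall j, (j < N)%nat ->
    P i (S j) = P i j \/ (B i j = false /\ B i (S j) = false)).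
  { intros i Hi j Hj.
    assert (Hfi : snd (f (h i)) = 0)
      by (destruct Hi as [->| ->]; rewrite ?h0, ?hN, ?f0, ?f1; reflexivity).
    assert (Hcell : signed_cell f g (fun s t => s = h i /\ (t = h j \/ t = h (S j)))).
    { destruct Hi as [->| ->].
      - destruct (cell O j ltac:(lia) Hj) as [H|[H|[H|H]]];
          [left|right; left|right; right; left|right; right; right];
          intros s t [-> Ht]; apply H; auto.
      - destruct N as [|N']; [lia|].
        destruct (cell N' j ltac:(lia) Hj) as [H|[H|[H|H]]];
          [left|right; left|right; right; left|right; right; right];
          intros s t [-> Ht]; apply H; auto. }
    unfold B, P; rewrite !Hfi.
    destruct Hcell as [H|[H|[H|H]]];
      pose proof (H (h i) (h j) ltac:(auto)) as H1;
      pose proof (H (h i) (h (S j)) ltac:(auto)) as H2;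
      rewrite ?Hfi in *.
    - left; destruct Rlt_dec, Rlt_dec; try reflexivity; lra.
    - left; destruct Rlt_dec, Rlt_dec; try reflexivity; lra.
    - right; split; destruct Rle_dec; try reflexivity; lra.
    - exfalso; pose proof (Pg (h j) (h01 j ltac:(lia))); lra. }
  assert (parity := grid_parity N B P).
  rewrite (side_parity N (B N) (P N) (side N ltac:(auto))),
    (side_parity N (B O) (P O) (side O ltac:(auto))) in parity.
  (* At the end [c] of [f], one of [b] and [d] lies to the left, giving odd parity; at the end [a]
     neither does, giving even parity. *)
  unfold B, P in parity; rewrite !h0, !hN, f0, f1, g0, g1 in parity; simpl in parity.
  destruct (Rle_dec 0 0); [|lra].
  destruct (Rlt_dec b c); [|lra]; destruct (Rlt_dec d c); [lra|].
  destruct (Rlt_dec b a); [lra|]; destruct (Rlt_dec d a); [lra|].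
  simpl in parity; enough (true = false) by discriminate; apply parity.
  - intros i j Hi Hj; specialize (cell i j Hi Hj).
    destruct cell as [H|[H|[H|H]]];
      pose proof (H (h i) (h j) ltac:(auto)); pose proof (H (h (S i)) (h j) ltac:(auto));
      pose proof (H (h i) (h (S j)) ltac:(auto)); pose proof (H (h (S i)) (h (S j)) ltac:(auto));
      [right|right|left|left]; repeat split;
      repeat (destruct Rlt_dec || destruct Rle_dec); try reflexivity; lra.
  - intros i Hi.
    destruct Rle_dec as [|Hn]; [reflexivity|exfalso; apply Hn, Pf, h01, Hi].
  - intros i Hi.
    destruct Rle_dec as [|Hn]; [reflexivity|exfalso; apply Hn, Pf, h01, Hi].
Qed.


(** * Listing the monochromatic crossings *)

Definition mono_quadruples (col : nat -> nat -> bool) (n : nat) :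
  list (nat * nat * nat * nat) :=
  flat_map (fun d => flat_map (fun c => flat_map (fun b => flat_map (fun a =>
    if eqb (col a c) (col b d) then (a, b, c, d) :: nil else nil)
    (seq 0 b)) (seq 0 c)) (seq 0 d)) (seq 0 n).

Lemma length_flat_map_seq (A : Type) (F : nat -> list A) (n : nat) :
  Z.of_nat (length (flat_map F (seq 0 n))) =
  zsum n (fun i => Z.of_nat (length (F i))).
Proof.
  induction n as [|n IH]; [reflexivity|].
  rewrite seq_S, flat_map_app, length_app, Nat2Z.inj_add, IH; cbn [zsum flat_map].
  rewrite app_nil_r; reflexivity.
Qed.

Lemma NoDup_flat_map_seq (A : Type) (F : nat -> list A) (key : A -> nat) (m n : nat) :
  (forall i, NoDup (F i)) -> (forall i x, In x (F i) -> key x = i) ->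
  NoDup (flat_map F (seq m n)).
Proof.
  intros HF Hkey; revert m; induction n as [|n IH]; intros m; [constructor|].
  cbn [seq flat_map]; apply NoDup_app; [apply HF|apply IH|].
  intros x Hx Hx'; apply in_flat_map in Hx' as [i [Hi Hxi]].
  apply in_seq in Hi; apply Hkey in Hx; apply Hkey in Hxi; lia.
Qed.

Lemma length_mono_quadruples col n :
  Z.of_nat (length (mono_quadruples col n)) = mono_crossings col n.
Proof.
  unfold mono_quadruples, mono_crossings, zsum4, zsum3, zsum2.
  rewrite length_flat_map_seq; apply zsum_ext; intros d _.
  rewrite length_flat_map_seq; apply zsum_ext; intros c _.
  rewrite length_flat_map_seq; apply zsum_ext; intros b _.
  rewrite length_flat_map_seq; apply zsum_ext; intros a _.
  destruct (eqb (col a c) (col b d)); reflexivity.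
Qed.

Lemma in_mono_quadruples col n a b c d :
  In (a, b, c, d) (mono_quadruples col n) <->
  (a < b < c)%nat /\ (c < d < n)%nat /\ col a c = col b d.
Proof.
  unfold mono_quadruples; split.
  - intros H.
    apply in_flat_map in H as [d' [Hd H]]; apply in_flat_map in H as [c' [Hc H]].
    apply in_flat_map in H as [b' [Hb H]]; apply in_flat_map in H as [a' [Ha H]].
    apply in_seq in Ha, Hb, Hc, Hd.
    destruct (eqb (col a' c') (col b' d')) eqn:E; [|destruct H].
    apply eqb_prop in E; destruct H as [H|[]]; inversion H; subst; intuition lia.
  - intros [H1 [H2 E]].
    apply in_flat_map; exists d; split; [apply in_seq; lia|].
    apply in_flat_map; exists c; split; [apply in_seq; lia|].
    apply in_flat_map; exists b; split; [apply in_seq; lia|].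
    apply in_flat_map; exists a; split; [apply in_seq; lia|].
    rewrite E, eqb_reflx; left; reflexivity.
Qed.

Lemma NoDup_mono_quadruples col n : NoDup (mono_quadruples col n).
Proof.
  unfold mono_quadruples.
  apply NoDup_flat_map_seq with (key := fun '(a, b, c, d) => d); [intros d|].
  1: apply NoDup_flat_map_seq with (key := fun '(a, b, c, d) => c); [intros c|].
  1: apply NoDup_flat_map_seq with (key := fun '(a, b, c, d) => b); [intros b|].
  1: apply NoDup_flat_map_seq with (key := fun '(a, b, c, d) => a); [intros a|].
  1: destruct eqb; repeat constructor; intros [].
  all: intros i [[[a' b'] c'] d'] H;
    repeat match goal with
    | H : In _ (flat_map _ _) |- _ => apply in_flat_map in H as [? [_ H]]
    end;
    match goal with H : In _ (if ?t then _ else _) |- _ => destruct t end;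
    simpl in H; intuition congruence.
Qed.

(** * Every drawing has a crossing for each monochromatic interleaved pair *)

(** Edges are indexed by increasing labels, whereas the order along the spine is arbitrary. *)
Definition edge_of (u v : nat) : nat * nat := (Nat.min u v, Nat.max u v).

Lemma edge_of_ends (u v : nat) :
  (fst (edge_of u v) = u /\ snd (edge_of u v) = v) \/
  (fst (edge_of u v) = v /\ snd (edge_of u v) = u).
Proof. unfold edge_of; simpl; lia. Qed.

Lemma edge_of_is_edge (n u v : nat) :
  (u < n)%nat -> (v < n)%nat -> u <> v -> is_edge n (edge_of u v).
Proof. unfold is_edge, edge_of; simpl; lia. Qed.

Definition to_upper (b : bool) (p : point) : point :=
  if b then p else (fst p, - snd p).

Lemma to_upper_inj (b : bool) (p q : point) : to_upper b p = to_upper b q -> p = q.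
Proof.
  destruct b, p as [x y], q as [x' y']; simpl; intros H; [exact H|].
  injection H as -> H; f_equal; lra.
Qed.

(** Reflection moves an arc of the lower page to the upper half-plane, and reversal of the parameter
    makes it start at [u]. *)
Lemma edge_path (n : nat) (D : drawing2 n) (u v : nat) :
  valid_drawing2 n D -> (u < n)%nat -> (v < n)%nat -> u <> v ->
  exists h, cont_on01 h /\ (forall t, in01 t -> 0 <= snd (h t)) /\
    h 0 = vertex_pt D u /\ h 1 = vertex_pt D v /\
    forall t, in01 t -> exists s, in01 s /\
      h t = to_upper (page D (edge_of u v)) (arc D (edge_of u v) s).
Proof.
  intros [_ HD] Hu Hv Huv; set (e := edge_of u v).
  destruct (HD e (edge_of_is_edge n u v Hu Hv Huv)) as [[Hc _] [H0 [H1 [Hp _]]]].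
  set (h := fun t => to_upper (page D e) (arc D e t)).
  assert (hc : cont_on01 h).
  { intros t Ht eps Heps; destruct (Hc t Ht eps Heps) as [delta [Hd H]].
    exists delta; split; [exact Hd|]; intros s Hs Hst.
    destruct (H s Hs Hst) as [Ha Hb]; unfold h, to_upper; destruct (page D e); [auto|].
    simpl; split; [exact Ha|].
    replace (- snd (arc D e s) - - snd (arc D e t))
      with (- (snd (arc D e s) - snd (arc D e t))) by ring.
    rewrite Rabs_Ropp; exact Hb. }
  assert (hp : forall t, in01 t -> 0 <= snd (h t)).
  { intros t Ht; specialize (Hp t Ht); unfold h, to_upper.
    destruct (page D e); simpl; lra. }
  assert (hv : forall k, to_upper (page D e) (vertex_pt D k) = vertex_pt D k).
  { intros k; unfold to_upper, vertex_pt; destruct (page D e); simpl; f_equal; lra. }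
  assert (h0 : h 0 = vertex_pt D (fst e)) by (unfold h; rewrite H0; apply hv).
  assert (h1 : h 1 = vertex_pt D (snd e)) by (unfold h; rewrite H1; apply hv).
  destruct (edge_of_ends u v) as [[E1 E2]|[E1 E2]]; fold e in E1, E2;
    rewrite E1 in h0; rewrite E2 in h1.
  - exists h; repeat split; auto; intros t Ht; exists t; auto.
  - assert (flip : forall t, in01 t -> in01 (1 - t)) by (unfold in01; intros; lra).
    exists (fun t => h (1 - t)); repeat split.
    + intros t Ht eps Heps; destruct (hc (1 - t) (flip t Ht) eps Heps) as [delta [Hd H]].
      exists delta; split; [exact Hd|]; intros s Hs Hst; apply H; [auto|].
      replace (1 - s - (1 - t)) with (- (s - t)) by ring; rewrite Rabs_Ropp; exact Hst.
    + intros t Ht; apply hp; auto.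
    + replace (1 - 0) with 1 by ring; exact h1.
    + replace (1 - 1) with 0 by ring; exact h0.
    + intros t Ht; exists (1 - t); split; [auto|reflexivity].
Qed.

(** Both arcs undergo the same reflection, so a meeting point of the paths is one of the arcs. It is
    interior to both, since an arc passes through no vertex but its own ends and the four vertices
    are distinct. *)
Lemma interleaved_edges_cross (n : nat) (D : drawing2 n) (a b c d : nat) :
  valid_drawing2 n D ->
  (a < n)%nat -> (b < n)%nat -> (c < n)%nat -> (d < n)%nat ->
  Defs.pos D a < Defs.pos D b -> Defs.pos D b < Defs.pos D c ->
  Defs.pos D c < Defs.pos D d ->
  page D (edge_of a c) = page D (edge_of b d) ->
  exists s t, in01_open s /\ in01_open t /\
    arc D (edge_of a c) s = arc D (edge_of b d) t.
Proof.
  intros HD Ha Hb Hc Hd Hab Hbc Hcd Hpage.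
  assert (ne : forall u v, Defs.pos D u < Defs.pos D v -> u <> v)
    by (intros u v H ->; lra).
  pose proof (ne a b Hab); pose proof (ne b c Hbc); pose proof (ne c d Hcd).
  assert (a <> c) by (apply ne; lra); assert (b <> d) by (apply ne; lra).
  assert (a <> d) by (apply ne; lra).
  destruct (edge_path n D a c HD Ha Hc) as [f [fc [fp [f0 [f1 fa]]]]]; [auto|].
  destruct (edge_path n D b d HD Hb Hd) as [g [gc [gp [g0 [g1 ga]]]]]; [auto|].
  destruct (interleaved_paths_meet f g _ _ _ _ fc gc fp gp f0 f1 g0 g1 Hab Hbc Hcd)
    as [s' [t' [Hs' [Ht' E]]]].
  destruct (fa s' Hs') as [s [Hs Es]]; destruct (ga t' Ht') as [t [Ht Et]].
  rewrite Es, Et, Hpage in E; apply to_upper_inj in E; clear s' t' Hs' Ht' Es Et.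
  destruct HD as [_ HD].
  destruct (HD (edge_of a c)) as [_ [e0 [e1 [_ ev]]]]; [apply edge_of_is_edge; auto|].
  destruct (HD (edge_of b d)) as [_ [k0 [k1 [_ kv]]]]; [apply edge_of_is_edge; auto|].
  pose proof (edge_of_ends a c) as Hac; pose proof (edge_of_ends b d) as Hbd.
  exists s, t; repeat split; try (unfold in01 in *; lra); auto.
  - destruct (Req_dec s 0) as [->|]; [exfalso|unfold in01 in *; lra].
    rewrite e0 in E; apply eq_sym, kv in E; [lia|exact Ht|lia].
  - destruct (Req_dec s 1) as [->|]; [exfalso|unfold in01 in *; lra].
    rewrite e1 in E; apply eq_sym, kv in E; [lia|exact Ht|lia].
  - destruct (Req_dec t 0) as [->|]; [exfalso|unfold in01 in *; lra].
    rewrite k0 in E; apply ev in E; [lia|exact Hs|lia].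
  - destruct (Req_dec t 1) as [->|]; [exfalso|unfold in01 in *; lra].
    rewrite k1 in E; apply ev in E; [lia|exact Hs|lia].
Qed.

Lemma sort_positions (n : nat) (p : nat -> R) :
  (forall i j, (i < n)%nat -> (j < n)%nat -> p i = p j -> i = j) ->
  exists sigma : nat -> nat, (forall i, (i < n)%nat -> (sigma i < n)%nat) /\
    forall i j, (i < j)%nat -> (j < n)%nat -> p (sigma i) < p (sigma j).
Proof.
  induction n as [|n IH]; intros Hinj.
  { exists (fun i => i); split; intros; lia. }
  destruct IH as [sigma [Hs Hlt]]; [intros i j Hi Hj E; apply Hinj; [lia|lia|exact E]|].
  (* Insertion step: [k] is the place of the new vertex [n] among the vertices already sorted. *)
  assert (cut : forall m, (m <= n)%nat -> exists k, (k <= m)%nat /\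
    (forall i, (i < k)%nat -> p (sigma i) < p n) /\
    (forall i, (k <= i)%nat -> (i < m)%nat -> p n < p (sigma i))).
  { induction m as [|m IHm]; intros Hm; [exists O; repeat split; intros; lia|].
    destruct (IHm ltac:(lia)) as [k [Hk [H1 H2]]].
    assert (p (sigma m) <> p n).
    { intros E; apply Hinj in E; [|specialize (Hs m); lia|lia].
      specialize (Hs m ltac:(lia)); lia. }
    destruct (Rlt_dec (p (sigma m)) (p n)) as [Hmn|Hmn].
    - exists (S m); repeat split; [lia| |intros; lia].
      intros i Hi; destruct (Nat.eq_dec i m) as [->|]; [exact Hmn|].
      assert (p (sigma i) < p (sigma m)) by (apply Hlt; lia); lra.
    - exists k; repeat split; [lia|exact H1|].
      intros i Hi Him; destruct (Nat.eq_dec i m) as [->|]; [lra|apply H2; lia]. }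
  destruct (cut n (le_n n)) as [k [Hk [H1 H2]]].
  exists (fun i => if (i <? k)%nat then sigma i else if (i =? k)%nat then n else sigma (i - 1)%nat).
  split.
  - intros i Hi; destruct (Nat.ltb_spec i k), (Nat.eqb_spec i k); try lia;
      [specialize (Hs i)|specialize (Hs (i - 1)%nat)]; lia.
  - intros i j Hij Hj.
    destruct (Nat.ltb_spec i k), (Nat.eqb_spec i k), (Nat.ltb_spec j k), (Nat.eqb_spec j k);
      try lia; try (apply Hlt; lia); try (apply H1; lia); try (apply H2; lia).
Qed.

Definition edge_ltb (e f : nat * nat) : bool :=
  ((fst e <? fst f) || ((fst e =? fst f) && (snd e <? snd f)))%nat.

(** Colour by pages after sorting along the spine. Distinct monochromatic quadruples give distinct
    unordered pairs of edges, each occurring in the list of crossings. *)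
Lemma drawing_lower_bound (n : nat) (D : drawing2 n) (k : nat) :
  valid_drawing2 n D -> cr_le n D k ->
  exists col, (mono_crossings col n <= Z.of_nat k)%Z.
Proof.
  intros HD [L [HL Hcr]].
  destruct (sort_positions n (Defs.pos D) (proj1 HD)) as [sigma [Hs Hlt]].
  set (edge := fun i j => edge_of (sigma i) (sigma j)).
  set (col := fun i j => page D (edge i j)).
  exists col; rewrite <- length_mono_quadruples; apply inj_le.
  assert (sinj : forall i j, (i < n)%nat -> (j < n)%nat -> sigma i = sigma j -> i = j).
  { intros i j Hi Hj E; destruct (Nat.lt_total i j) as [H|[H|H]]; [|exact H|];
      pose proof (Hlt _ _ H ltac:(lia)) as H'; rewrite E in H'; lra. }
  assert (edge_inj : forall i j i' j', (i < j)%nat -> (j < n)%nat -> (i' < j')%nat ->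
    (j' < n)%nat -> edge i j = edge i' j' -> i = i' /\ j = j').
  { intros i j i' j' Hij Hj Hij' Hj' E; unfold edge in E.
    pose proof (edge_of_ends (sigma i) (sigma j)) as H1.
    pose proof (edge_of_ends (sigma i') (sigma j')) as H2; rewrite E in H1.
    destruct H1 as [[H1 H1']|[H1 H1']], H2 as [[H2 H2']|[H2 H2']]; rewrite H1 in H2;
      rewrite H1' in H2'; apply sinj in H2; apply sinj in H2'; lia. }
  (* The pair is put in the lexicographic order required by [crossing]. *)
  set (phi := fun q : nat * nat * nat * nat => let '(a, b, c, d) := q in
    if edge_ltb (edge a c) (edge b d) then (edge a c, edge b d) else (edge b d, edge a c)).
  (* Forgetting the point: one crossing for each pair of edges is enough. *)
  set (pr := fun x : point * (nat * nat) * (nat * nat) => (snd (fst x), snd x)).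
  apply Nat.le_trans with (length L); [|exact HL].
  rewrite <- (length_map phi), <- (length_map pr L); apply NoDup_incl_length.
  - apply NoDup_map_NoDup_ForallPairs; [|apply NoDup_mono_quadruples].
    intros [[[a b] c] d] [[[a' b'] c'] d'] H H' E.
    apply in_mono_quadruples in H as [H1 [H2 _]], H' as [H1' [H2' _]].
    unfold phi in E; destruct edge_ltb, edge_ltb;
      pose proof (f_equal fst E) as E1; pose proof (f_equal snd E) as E2;
      cbn [fst snd] in E1, E2;
      (* Equality with the roles exchanged would give [a = b'] and [b = a'], against [a < b] and
         [a' < b']. *)
      apply edge_inj in E1; apply edge_inj in E2; try lia;
      destruct E1, E2; subst; try reflexivity; lia.
  - intros ef H; apply in_map_iff in H as [[[[a b] c] d] [<- H]].
    apply in_mono_quadruples in H as [H1 [H2 Hcol]].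
    destruct (interleaved_edges_cross n D (sigma a) (sigma b) (sigma c) (sigma d) HD)
      as [s [t [Hs' [Ht' E]]]]; try (apply Hs; lia); try (apply Hlt; lia); [exact Hcol|].
    assert (Hac : is_edge n (edge a c)).
    { apply edge_of_is_edge; try (apply Hs; lia); intros Eq; apply sinj in Eq; lia. }
    assert (Hbd : is_edge n (edge b d)).
    { apply edge_of_is_edge; try (apply Hs; lia); intros Eq; apply sinj in Eq; lia. }
    apply in_map_iff; unfold phi.
    destruct (edge_ltb (edge a c) (edge b d)) eqn:Elt; unfold edge_ltb in Elt.
    + exists (arc D (edge a c) s, edge a c, edge b d); split; [reflexivity|].
      apply Hcr; repeat split; try apply Hac; try apply Hbd; [unfold edge_lt; lia|].
      exists s, t; auto.
    + exists (arc D (edge a c) s, edge b d, edge a c); split; [reflexivity|].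
      apply Hcr; repeat split; try apply Hac; try apply Hbd; [|exists t, s; auto].
      assert (edge a c <> edge b d) by (intros Eq; apply edge_inj in Eq; lia).
      unfold edge_lt; destruct (Nat.eq_dec (fst (edge a c)) (fst (edge b d))) as [E1|];
        [|lia].
      destruct (Nat.eq_dec (snd (edge a c)) (snd (edge b d))) as [E2|]; [|lia].
      exfalso; apply H, injective_projections; assumption.
Qed.


(** * The parabolic drawing of a colouring *)

Definition page_sign (b : bool) : R := if b then 1 else -1.

(* The arc of [a b] is the parabola [y = +- (x - a) (b - x)]; all these
   parabolas have the same curvature, so two of them on one page meet at most
   once. *)
Definition parabolic_drawing (n : nat) (col : nat -> nat -> bool) : drawing2 n :=
  Drawing2 n INR (fun e => col (fst e) (snd e))
    (fun e t =>
       let w := INR (snd e) - INR (fst e) in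
       (INR (fst e) + t * w, page_sign (col (fst e) (snd e)) * (t * (1 - t) * (w * w)))).

Lemma parabolic_drawing_valid (n : nat) (col : nat -> nat -> bool) :
  valid_drawing2 n (parabolic_drawing n col).
Proof.
  split; [intros i j _ _; apply INR_eq|].
  intros [a b] [Hab Hb]; cbn [fst snd] in *.
  apply lt_INR in Hab.
  unfold simple_arc, vertex_pt, parabolic_drawing; cbn [Defs.pos page arc fst snd].
  set (w := INR b - INR a); assert (Hw : 0 < w) by (unfold w; lra).
  set (sg := page_sign (col a b)).
  assert (Hsg : sg = 1 /\ col a b = true \/ sg = -1 /\ col a b = false)
    by (unfold sg; destruct (col a b); auto).
  repeat split.
  - intros t Ht eps Heps; cbn [fst snd].
    (* The coordinates are Lipschitz with constants [w] and [w * w], since the factor [1 - s - t] is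
       at most 1 in absolute value. *)
    exists (Rmin (eps / (2 * w)) (eps / (2 * (w * w)))).
    assert (Hww : 0 < w * w) by nra.
    split; [apply Rmin_pos; apply Rdiv_lt_0_compat; lra|].
    intros s Hs Hst; set (u := Rabs (s - t)) in *.
    assert (Hu : 0 <= u) by apply Rabs_pos.
    pose proof (Rmin_l (eps / (2 * w)) (eps / (2 * (w * w)))).
    pose proof (Rmin_r (eps / (2 * w)) (eps / (2 * (w * w)))).
    assert (Hu1 : u * w < eps).
    { apply Rle_lt_trans with (eps / (2 * w) * w); [apply Rmult_le_compat_r; lra|].
      replace (eps / (2 * w) * w) with (eps / 2) by (field; lra); lra. }
    assert (Hu2 : u * (w * w) < eps).
    { apply Rle_lt_trans with (eps / (2 * (w * w)) * (w * w)); [apply Rmult_le_compat_r; lra|].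
      replace (eps / (2 * (w * w)) * (w * w)) with (eps / 2) by (field; lra); lra. }
    split.
    + replace (INR a + s * w - (INR a + t * w)) with ((s - t) * w) by ring.
      rewrite Rabs_mult, (Rabs_right w) by lra; exact Hu1.
    + replace (sg * (s * (1 - s) * (w * w)) - sg * (t * (1 - t) * (w * w)))
        with (sg * ((s - t) * ((1 - s - t) * (w * w)))) by ring.
      rewrite !Rabs_mult, (Rabs_right w) by lra; fold u.
      assert (Hsg1 : Rabs sg = 1)
        by (destruct Hsg as [[-> _]|[-> _]]; unfold Rabs; destruct Rcase_abs; lra).
      assert (Rabs (1 - s - t) <= 1)
        by (unfold in01 in *; unfold Rabs; destruct Rcase_abs; lra).
      assert (0 <= u * (w * w) * (1 - Rabs (1 - s - t)))
        by (apply Rmult_le_pos; [apply Rmult_le_pos|]; lra).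
      rewrite Hsg1; lra.
  - intros s t _ _ E; injection E as E _; nra.
  - f_equal; ring.
  - unfold w; f_equal; ring.
  - intros t Ht.
    assert (0 <= t * (1 - t) * (w * w)) by (unfold in01 in *; apply Rmult_le_pos; nra).
    destruct Hsg as [[-> ->]|[-> ->]]; lra.
  - intros t k Ht _ E; injection E as E1 E2.
    assert (E3 : t * (1 - t) = 0).
    { assert (t * (1 - t) * (w * w) = 0) by (destruct Hsg as [[Hs _]|[Hs _]]; rewrite Hs in E2; lra).
      apply Rmult_eq_reg_r with (w * w); nra. }
    apply Rmult_integral in E3 as [E3|E3].
    + left; apply INR_eq; rewrite E3 in E1; lra.
    + right; apply INR_eq; replace t with 1 in E1 by lra; unfold w in E1; lra.
Qed.

(** The quadratic terms cancel, leaving a linear equation for [x]. If [d <= c], the arc over [b, d]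
    would lie strictly below the other one. *)
Lemma parabolas_meet (a b c d x : R) :
  a < x < c -> b < x < d -> (x - a) * (c - x) = (x - b) * (d - x) ->
  a < b -> c < d /\ x = (b * d - a * c) / (b + d - a - c).
Proof.
  intros Hac Hbd E Hab.
  assert (Hcd : c < d) by (apply Rnot_le_lt; intros H; nra).
  split; [exact Hcd|].
  apply Rmult_eq_reg_r with (b + d - a - c); [|lra].
  unfold Rdiv; rewrite Rmult_assoc, Rinv_l by lra; lra.
Qed.

(** Interior points of an arc are off the spine, so meeting arcs share a page. [parabolas_meet] then
    forces interleaving and determines the point from the quadruple. *)
Lemma parabolic_drawing_crossings (n : nat) (col : nat -> nat -> bool) :
  cr_le n (parabolic_drawing n col) (length (mono_quadruples col n)).
Proof.
  exists (map (fun q : nat * nat * nat * nat => let '(a, b, c, d) := q in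
    let x := (INR b * INR d - INR a * INR c) / (INR b + INR d - INR a - INR c) in
    (x, page_sign (col a c) * ((x - INR a) * (INR c - x)), (a, c), (b, d)))
    (mono_quadruples col n)).
  split; [rewrite length_map; apply le_n|].
  intros [[p [a c]] [b d]] [[Hac Hc] [[Hbd Hd] [Hlt [s [t [Hs [Ht [Es Et]]]]]]]].
  unfold parabolic_drawing in Es, Et; cbn [arc fst snd] in *.
  pose proof (lt_INR _ _ Hac) as Rac; pose proof (lt_INR _ _ Hbd) as Rbd.
  set (x := INR a + s * (INR c - INR a)) in *.
  assert (Ey : s * (1 - s) * ((INR c - INR a) * (INR c - INR a)) =
               (x - INR a) * (INR c - x)) by (unfold x; ring).
  rewrite Ey in Es; clear Ey.
  rewrite <- Es in Et; injection Et as Ex Ey.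
  assert (Ey' : t * (1 - t) * ((INR d - INR b) * (INR d - INR b)) =
                (x - INR b) * (INR d - x)) by (rewrite <- Ex; ring).
  rewrite Ey' in Ey; clear Ey'.
  assert (Hx : INR a < x < INR c) by (unfold in01_open, x in *; nra).
  assert (Hx' : INR b < x < INR d) by (unfold in01_open in *; nra).
  assert (0 < (x - INR a) * (INR c - x)) by nra.
  assert (0 < (x - INR b) * (INR d - x)) by nra.
  assert (Hcol : col a c = col b d).
  { unfold page_sign in Ey; destruct (col a c), (col b d); try reflexivity; lra. }
  assert (E : (x - INR a) * (INR c - x) = (x - INR b) * (INR d - x)).
  { rewrite Hcol in Ey; unfold page_sign in Ey; destruct (col b d); lra. }
  (* Arcs with a common left end and different right ends have different heights over each interior
     [x]. *)
  assert (Hab : (a < b)%nat).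
  { destruct Hlt as [H1|[H1 H2]]; [exact H1|exfalso].
    cbn [fst snd] in *; subst b; apply lt_INR in H2; nra. }
  pose proof (lt_INR _ _ Hab) as Rab.
  destruct (parabolas_meet _ _ _ _ x Hx Hx' E Rab) as [Rcd ->].
  apply in_map_iff; exists (a, b, c, d); split; [rewrite <- Es; reflexivity|].
  apply in_mono_quadruples.
  assert ((b < c)%nat) by (apply INR_lt; lra); apply INR_lt in Rcd; auto.
Qed.

Lemma Zn_four_Z (n : nat) : Zn n = / 4 * IZR (four_Z n).
Proof. unfold Zn, Zfloor, four_Z; rewrite !mult_IZR; reflexivity. Qed.

(* nu_2(K_n) = Z(n): some valid 2-page drawing has at most Z(n) crossings,
   and every valid 2-page drawing has at least Z(n) crossings. *)
Theorem theorem7 (n : nat) (hn : (0 < n)%nat) :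
  (exists (D : drawing2 n) (k : nat),
      valid_drawing2 n D /\ cr_le n D k /\ INR k <= Zn n) /\
  (forall (D : drawing2 n) (k : nat),
      valid_drawing2 n D -> cr_le n D k -> Zn n <= INR k).
Proof.
  rewrite Zn_four_Z; split.
  - assert (exists col, (4 * mono_crossings col n = four_Z n)%Z) as [col Hcol].
    { destruct (Nat.Even_or_Odd n) as [[m Hm]|[M HM]].
      - destruct m as [|M]; [lia|].
        replace n with (2 * M + 2)%nat by lia.
        exists (colour (M + 1) 0); apply colour_even_mono_crossings.
      - subst n; exists (colour (M + 1) 1); apply colour_odd_mono_crossings. }
    exists (parabolic_drawing n col), (length (mono_quadruples col n)).
    split; [apply parabolic_drawing_valid|split; [apply parabolic_drawing_crossings|]].
    rewrite <- Hcol, <- length_mono_quadruples, mult_IZR, <- INR_IZR_INZ; lra.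
  - intros D k HD Hk.
    destruct (drawing_lower_bound n D k HD Hk) as [col Hcol].
    pose proof (mono_crossings_lower_bound col n hn) as Hlow.
    assert (H : IZR (four_Z n) <= IZR (4 * Z.of_nat k)) by (apply IZR_le; lia).
    rewrite mult_IZR, <- INR_IZR_INZ in H; lra.
Qed.
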